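(* Let $X$ be a second countable, locally compact, Hausdorff space, let $\sigma:X\to X$ be a local homeomorphism (not necessarily surjective), and let $\Gamma=\Gamma(X,\sigma)$ be the associated groupoid. Then for every $\Gamma$-sheaf $A$ and every $n\ge 0$, the map $\varphi_A: Z_\Gamma(A)\to S(A)$, $\varphi_A(f)(x)=f(x,1,\sigma(x))$, induces an isomorphism $$Z_\Gamma^n(A)\simeq H^n(X,A),$$ where $Z_\Gamma^n$ is the $n$-th right derived functor of the cocycle functor $Z_\Gamma$ on $\Gamma$-sheaves and $H^n(X,A)$ is the usual sheaf cohomology of $X$ with coefficients in (the underlying sheaf of) $A$.
   Context: Groupoid: $\Gamma(X,\sigma)=\{(x,m,y)\in X\times\mathbf{Z}\times X : \text{there are } k,l\ge 0 \text{ with } \sigma^k(x)=\sigma^l(y) \text{ and } k-l=m\}$, with $r(x,m,y)=x$, $s(x,m,y)=y$, $(x,m,y)(y,n,z)=(x,m+n,z)$, $(x,m,y)^{-1}=(y,-m,x)$. Its unit space $\Gamma^0=\{(x,0,x)\}$ is identified with $X$. The topology has as basis the sets $\{(x,k-l,y): x\in U,\ y\in V,\ \sigma^k(x)=\sigma^l(y)\}$, where $k,l\ge 0$ and $U,V\subset X$ are open sets on which $\sigma^k$, respectively $\sigma^l$, is injective; with it $\Gamma$ is a locally compact Hausdorff $r$-discrete (étale) groupoid. $\Gamma$-sheaf: a sheaf of abelian groups $A$ over $X$ (viewed as an étale space over $X$ with abelian group fibers $A_x$) on which $\Gamma$ acts continuously, i.e. each $\gamma\in\Gamma$ gives a group isomorphism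 $A_{s(\gamma)}\to A_{r(\gamma)}$, $a\mapsto\gamma a$, compatible with multiplication and units, and $(\gamma,a)\mapsto\gamma a$ is continuous. Morphisms are $\Gamma$-equivariant sheaf morphisms. The category of $\Gamma$-sheaves is abelian with enough injectives. Cocycle functor: $Z_\Gamma(A)$ is the abelian group of all continuous functions $f:\Gamma\to A$ such that $f(\gamma)\in A_{r(\gamma)}$ for all $\gamma\in\Gamma$ and $f(\gamma_1\gamma_2)=f(\gamma_1)+\gamma_1f(\gamma_2)$ for all composable pairs $(\gamma_1,\gamma_2)$. $S(A)=H^0(X,A)$ is the group of continuous sections of $A$ over $X$. Induced map: if $A\to Q^0\to Q^1\to\cdots$ is an injective resolution of $A$ in the category of $\Gamma$-sheaves, then $Z_\Gamma^n(A)$ is the $n$-th cohomology of the complex $Z_\Gamma(Q^\ast)$; the maps $\varphi_{Q^i}$ give a map of complexes $Z_\Gamma(Q^\ast)\to S(Q^\ast)$, and one composes the resulting map on cohomology with the canonical map $H^n(S(Q^\ast))\to H^n(X,A)$ attached to the resolution $Q^\ast$ of the sheaf $A$. *)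

(* Defs.v *)
From HB Require Import structures.
From mathcomp Require Import all_boot all_order all_algebra.
From mathcomp Require Import all_classical.
From mathcomp Require Import topology.

Set Implicit Arguments.
Unset Strict Implicit.
Unset Printing Implicit Defensive.

Import GRing.Theory.

Local Open Scope classical_set_scope.
Local Open Scope ring_scope.
Local Open Scope quotient_scope.

Record cochain_complex := CochainComplex {
  cobj :> nat -> zmodType;
  cd : forall n, {additive cobj n -> cobj n.+1};
  cdd : forall n a, cd n.+1 (cd n a) = 0 }.

Section Cohomology.
Variables (C : cochain_complex) (n : nat).

Definition is_cycle : {pred C n} := fun a => cd C n a == 0.

Lemma is_cycle_zmod : zmod_closed is_cycle.
Proof.
split=> [|a b]; rewrite !unfold_in /is_cycle ?raddf0// raddfB.
by move=> /eqP-> /eqP->; rewrite subr0.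
Qed.
HB.instance Definition _ := GRing.isZmodClosed.Build (C n) is_cycle is_cycle_zmod.

Record cycles := Cycle { cycle_val : C n; _ : is_cycle cycle_val }.
HB.instance Definition _ := [isSub for cycle_val].
HB.instance Definition _ := [Choice of cycles by <:].
HB.instance Definition _ := [SubChoice_isSubZmodule of cycles by <:].

End Cohomology.

(* The complex is extended by zero in degree -1, so that H^0 is a kernel. *)
Definition is_boundary (C : cochain_complex) (n : nat) : C n -> Prop :=
  match n with
  | 0%N => fun a => a = 0
  | m.+1 => fun a => exists b, cd C m b = a
  end.

Section CohomologyGroup.
Variables (C : cochain_complex) (n : nat).

Definition boundary_cycles : {pred cycles C n} :=
  fun z => `[< is_boundary (val z) >].

Lemma boundary_cycles_zmod : zmod_closed boundary_cycles.
Proof.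
rewrite /boundary_cycles; case: n => [|m]; split=> [|a b].
- exact/asboolP.
- by move=> /asboolP/= a0 /asboolP/= b0; apply/asboolP; rewrite /= a0 b0 subrr.
- by apply/asboolP; exists 0; rewrite raddf0.
- move=> /asboolP[a' /= a'E] /asboolP[b' /= b'E]; apply/asboolP.
  by exists (a' - b'); rewrite raddfB a'E b'E.
Qed.
HB.instance Definition _ :=
  GRing.isZmodClosed.Build (cycles C n) boundary_cycles boundary_cycles_zmod.

Definition cohomology : zmodType := Quotient.quot boundary_cycles.

Definition cohomology_class (z : cycles C n) : cohomology := \pi_cohomology z.

End CohomologyGroup.

Record cochain_map (C D : cochain_complex) := CochainMap {
  cmap :> forall n, {additive C n -> D n};
  cmapd : forall n a, cmap n.+1 (cd C n a) = cd D n (cmap n a) }.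

Lemma is_boundary_map (C D : cochain_complex) (f : cochain_map C D) n
    (a : C n) : is_boundary a -> is_boundary (f n a).
Proof.
case: n a => [|m] a /= => [->|[b <-]]; first exact: raddf0.
by exists (f m b); rewrite cmapd.
Qed.

Section CohomologyMap.
Variables (C D : cochain_complex) (f : cochain_map C D) (n : nat).

Lemma cycles_map_subproof (z : cycles C n) : is_cycle (f n (cycle_val z)).
Proof. by case: z => a /= /eqP ca; rewrite /is_cycle -cmapd ca raddf0. Qed.

Definition cycles_map (z : cycles C n) : cycles D n :=
  Cycle (cycles_map_subproof z).

Definition cohomology_map (c : cohomology C n) : cohomology D n :=
  cohomology_class (cycles_map (repr c)).

Lemma cohomology_mapE (z : cycles C n) :
  cohomology_map (cohomology_class z) = cohomology_class (cycles_map z).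
Proof.
apply/eqP; rewrite /cohomology_map /cohomology_class -Quotient.idealrBE.
have : (repr (\pi z : cohomology C n) - z) \in @boundary_cycles C n.
  by rewrite Quotient.idealrBE reprK.
move: (repr _) => w; rewrite !unfold_in => /asboolP wz; apply/asboolP.
have := is_boundary_map f wz.
by rewrite /= raddfB.
Qed.

Lemma cohomology_map_additive : zmod_morphism cohomology_map.
Proof.
move=> c d; rewrite -[c]reprK -[d]reprK.
set z := repr c; set w := repr d.
have piB k E (u v : cycles E k) :
  cohomology_class (u - v) = cohomology_class u - cohomology_class v.
  by rewrite /cohomology_class raddfB.
rewrite -!/(cohomology_class _) -piB !cohomology_mapE -piB; congr cohomology_class.
by apply: val_inj; rewrite /= raddfB.
Qed.
HB.instance Definition _ := GRing.isZmodMorphism.Build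
  (cohomology C n) (cohomology D n) cohomology_map cohomology_map_additive.

End CohomologyMap.

Definition local_homeomorphism (T U : topologicalType) (f : T -> U) : Prop :=
  forall x, exists2 V : set T, open_nbhs x V &
    [/\ {in V, continuous f}, set_inj V f &
        forall W, W `<=` V -> open W -> open (f @` W)].

Definition total_space (X : Type) (S : X -> zmodType) : Type := {x : X & S x}.
HB.instance Definition _ (X : choiceType) (S : X -> zmodType) :=
  Choice.copy (total_space S) {x : X & S x}.

(* A family of abelian groups indexed by X with a topology on its total space;
   the disjoint-union topology on sigma types is not the one in use. *)
Record group_bundle (X : topologicalType) := GroupBundle {
  stalk :> X -> zmodType;
  total_topology : isOpenTopological (total_space stalk) }.

Definition etale (X : topologicalType) (A : group_bundle X) : Type :=
  total_space A.
HB.instance Definition _ (X : topologicalType) (A : group_bundle X) :=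
  Choice.copy (etale A) (total_space A).
HB.instance Definition _ (X : topologicalType) (A : group_bundle X) :=
  (total_topology A : isOpenTopological (etale A)).

Section Etale.
Variables (X : topologicalType) (A : group_bundle X).

Definition etale_pt (x : X) (a : A x) : etale A := existT _ x a.

Definition etale_proj (e : etale A) : X := projT1 e.

Definition fibre_square : choiceType := {x : X & (A x * A x)%type}.

Definition fibre_square_pair (u : fibre_square) : etale A * etale A :=
  (etale_pt (projT2 u).1, etale_pt (projT2 u).2).

Definition fibre_square_add (u : fibre_square) : etale A :=
  etale_pt ((projT2 u).1 + (projT2 u).2).

End Etale.

(* The addition is defined on the fibre product of the etale space with itself,
   which carries the topology induced by the product. *)
Record sheaf (X : topologicalType) := Sheaf {
  sheaf_bundle :> group_bundle X;
  sheaf_local_homeo : local_homeomorphism (@etale_proj X sheaf_bundle);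
  sheaf_zero_cont : continuous (fun x => etale_pt (0 : sheaf_bundle x));
  sheaf_opp_cont :
    continuous (fun e : etale sheaf_bundle => etale_pt (- projT2 e));
  sheaf_add_cont :
    continuous (@fibre_square_add X sheaf_bundle :
                  initial_topology (@fibre_square_pair X sheaf_bundle) -> _) }.

Record sheaf_hom (X : topologicalType) (A B : sheaf X) := SheafHom {
  sheaf_hom_fun :> forall x, {additive A x -> B x};
  sheaf_hom_cont : continuous
    (fun e : etale A => etale_pt (sheaf_hom_fun (projT1 e) (projT2 e))) }.

(* For sheaves as etale spaces, monomorphisms and exactness are stalkwise. *)
Definition stalkwise_injective (X : topologicalType) (A B : sheaf X)
  (f : sheaf_hom A B) : Prop := forall x, injective (f x).

Definition exact_pair (X : topologicalType) (A B C : sheaf X)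
    (f : sheaf_hom A B) (g : sheaf_hom B C) : Prop :=
  forall x (b : B x), g x b = 0 <-> exists a, f x a = b.

Definition injective_sheaf (X : topologicalType) (J : sheaf X) : Prop :=
  forall (A B : sheaf X) (i : sheaf_hom A B) (f : sheaf_hom A J),
    stalkwise_injective i ->
    exists g : sheaf_hom B J, forall x a, g x (i x a) = f x a.

Record sheaf_complex (X : topologicalType) := SheafComplex {
  scobj :> nat -> sheaf X;
  scd : forall n, sheaf_hom (scobj n) (scobj n.+1);
  scdd : forall n x a, scd n.+1 x (scd n x a) = 0 }.

Definition is_resolution (X : topologicalType) (A : sheaf X)
    (Q : sheaf_complex X) (e : sheaf_hom A (Q 0%N)) : Prop :=
  [/\ stalkwise_injective e, exact_pair e (scd Q 0) &
      forall n, exact_pair (scd Q n) (scd Q n.+1)].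

Record injective_resolution (X : topologicalType) (A : sheaf X) :=
  InjectiveResolution {
    ires :> sheaf_complex X;
    ires_aug : sheaf_hom A (ires 0%N);
    ires_exact : is_resolution ires_aug;
    ires_inj : forall n, injective_sheaf (ires n) }.

Section ContinuousGroupOps.
Variables (X Y : topologicalType) (A : sheaf X) (u : Y -> X).
Implicit Types a b : forall y, A (u y).

Lemma etale_add_continuous a b :
  continuous (fun y => etale_pt (a y)) -> continuous (fun y => etale_pt (b y)) ->
  continuous (fun y => etale_pt (a y + b y)).
Proof.
move=> ca cb.
pose w (y : Y) : initial_topology (@fibre_square_pair X A) :=
  existT (fun x => (A x * A x)%type) (u y) (a y, b y).
have cw : continuous w.
  apply: continuous_comp_initial => y.
  exact: (cvg_pair (ca y) (cb y)).
move=> y; exact: (continuous_comp (cw y) (@sheaf_add_cont X A (w y))).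
Qed.

Lemma etale_opp_continuous a :
  continuous (fun y => etale_pt (a y)) ->
  continuous (fun y => etale_pt (- a y)).
Proof.
move=> ca y.
exact: (continuous_comp (ca y) (@sheaf_opp_cont X A (etale_pt (a y)))).
Qed.

Lemma etale_zero_continuous :
  continuous u -> continuous (fun y => etale_pt (0 : A (u y))).
Proof. by move=> cu y; exact: (continuous_comp (cu y) (@sheaf_zero_cont X A (u y))). Qed.

End ContinuousGroupOps.

Section GlobalSections.
Variables (X : topologicalType) (A : sheaf X).

Record global_section := GlobalSection {
  gsec :> forall x, A x;
  gsec_cont : continuous (fun x => etale_pt (gsec x)) }.

Lemma global_section_ext (s t : global_section) :
  (forall x, s x = t x) -> s = t.
Proof.
case: s t => [s cs] [t ct] /= st; have est : s = t by exact: functional_extensionality_dep.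
by case: _ / est in ct *; congr GlobalSection; exact: Prop_irrelevance.
Qed.

HB.instance Definition _ := gen_eqMixin global_section.
HB.instance Definition _ := gen_choiceMixin global_section.

Definition gsec0 :=
  GlobalSection (@etale_zero_continuous X X A id (fun x => @cvg_id X (nbhs x))).
Definition gsec_opp (s : global_section) :=
  GlobalSection (etale_opp_continuous (@gsec_cont s)).
Definition gsec_add (s t : global_section) :=
  GlobalSection (etale_add_continuous (@gsec_cont s) (@gsec_cont t)).

Lemma gsec_addA : associative gsec_add.
Proof. by move=> r s t; apply: global_section_ext => x /=; rewrite addrA. Qed.
Lemma gsec_addC : commutative gsec_add.
Proof. by move=> s t; apply: global_section_ext => x /=; rewrite addrC. Qed.
Lemma gsec_add0 : left_id gsec0 gsec_add.
Proof. by move=> s; apply: global_section_ext => x /=; rewrite add0r. Qed.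
Lemma gsec_addN : left_inverse gsec0 gsec_opp gsec_add.
Proof. by move=> s; apply: global_section_ext => x /=; rewrite addNr. Qed.
HB.instance Definition _ := GRing.isZmodule.Build global_section
  gsec_addA gsec_addC gsec_add0 gsec_addN.

End GlobalSections.

Section GlobalSectionsMap.
Variables (X : topologicalType) (A B : sheaf X) (h : sheaf_hom A B).

Lemma gsec_map_cont (s : global_section A) :
  continuous (fun x => etale_pt (h x (s x))).
Proof.
move=> x.
exact: (continuous_comp (@gsec_cont _ _ s x) (@sheaf_hom_cont _ _ _ h (etale_pt (s x)))).
Qed.

Definition gsec_map (s : global_section A) : global_section B :=
  GlobalSection (@gsec_map_cont s).

Lemma gsec_map_additive : zmod_morphism gsec_map.
Proof. by move=> s t; apply: global_section_ext => x /=; rewrite raddfB. Qed.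
HB.instance Definition _ := GRing.isZmodMorphism.Build
  (global_section A) (global_section B) gsec_map gsec_map_additive.

End GlobalSectionsMap.

Section SectionComplex.
Variable X : topologicalType.

Lemma section_complex_dd (Q : sheaf_complex X) n (s : global_section (Q n)) :
  gsec_map (scd Q n.+1) (gsec_map (scd Q n) s) = 0.
Proof. by apply: global_section_ext => x; exact: scdd. Qed.

Definition section_complex (Q : sheaf_complex X) : cochain_complex :=
  @CochainComplex (fun n => global_section (Q n)) (fun n => gsec_map (scd Q n))
    (@section_complex_dd Q).

Record complex_hom (Q R : sheaf_complex X) := ComplexHom {
  chom :> forall n, sheaf_hom (Q n) (R n);
  chomd : forall n x a, chom n.+1 x (scd Q n x a) = scd R n x (chom n x a) }.

Lemma section_complex_map_d (Q R : sheaf_complex X) (f : complex_hom Q R) n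
    (s : global_section (Q n)) :
  gsec_map (f n.+1) (gsec_map (scd Q n) s) = gsec_map (scd R n) (gsec_map (f n) s).
Proof. by apply: global_section_ext => x; exact: chomd. Qed.

Definition section_complex_map (Q R : sheaf_complex X) (f : complex_hom Q R) :
    cochain_map (section_complex Q) (section_complex R) :=
  @CochainMap (section_complex Q) (section_complex R)
    (fun n => gsec_map (f n)) (@section_complex_map_d Q R f).

End SectionComplex.

Section Groupoid.
Variables (X : topologicalType) (sigma : X -> X).

Definition tail_equiv (x : X) (m : int) (y : X) : Prop :=
  exists k l : nat, iter k sigma x = iter l sigma y /\ k%:Z - l%:Z = m.

Lemma tail_unit x : tail_equiv x 0 x.
Proof. by exists 0%N, 0%N. Qed.

Lemma tail_comp x m y n z :
  tail_equiv x m y -> tail_equiv y n z -> tail_equiv x (m + n) z.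
Proof.
move=> [k [l [kl <-]]] [k' [l' [kl' <-]]].
exists (k' + k)%N, (l + l')%N; split.
  by rewrite iterD kl -iterD addnC iterD kl' -iterD.
rewrite !PoszD opprD [k'%:Z + _]addrC !addrA; congr (_ - _).
by rewrite addrAC.
Qed.

Lemma tail_step x : tail_equiv x 1 (sigma x).
Proof. by exists 1%N, 0%N. Qed.

End Groupoid.

(* Composable pairs are arrows (x, m, y), (y, n, z) sharing the point y, with
   product Arrow (tail_comp p q); the units are the Arrow (tail_unit x).
   The hypothesis on sigma is a parameter because the sets [basic_bisection]
   form a basis only for a local homeomorphism. *)
Record groupoid (X : topologicalType) (sigma : X -> X)
    (sigma_lh : local_homeomorphism sigma) := Arrow {
  rng : X;
  deg : int;
  src : X;
  arrowP : tail_equiv sigma rng deg src }.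
Arguments Arrow {X sigma} sigma_lh {rng deg src} arrowP.

HB.instance Definition _ X sigma sigma_lh :=
  gen_eqMixin (@groupoid X sigma sigma_lh).
HB.instance Definition _ X sigma sigma_lh :=
  gen_choiceMixin (@groupoid X sigma sigma_lh).

Section GroupoidTopology.
Variables (X : topologicalType) (sigma : X -> X).
Hypothesis sigma_lh : local_homeomorphism sigma.
Local Notation Gamma := (groupoid sigma_lh).

Definition basic_index : Type := (set X * set X * nat * nat)%type.

Definition basic_domain : set basic_index :=
  [set i | let: (U, V, k, l) := i in
    [/\ open U, open V, set_inj U (iter k sigma) & set_inj V (iter l sigma)]].

Definition basic_bisection (i : basic_index) : set Gamma :=
  let: (U, V, k, l) := i in
  [set g | [/\ U (rng g), V (src g), deg g = k%:Z - l%:Z &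
               iter k sigma (rng g) = iter l sigma (src g)]].

Lemma sigma_continuous : continuous sigma.
Proof.
by move=> x; have [V [_ Vx] [cV _ _]] := sigma_lh x; apply: cV; rewrite inE.
Qed.

Lemma iter_locally_injective k x :
  exists2 U, open_nbhs x U & set_inj U (iter k sigma).
Proof.
elim: k x => [|k IH] x; first by exists setT => //; split=> //; exact: openT.
have [U [oU Ux] [_ injU _]] := sigma_lh x.
have [V [oV Vx] injV] := IH (sigma x).
exists (U `&` sigma @^-1` V).
  split=> //; apply: openI => //.
  by move/continuousP: sigma_continuous; exact.
move=> y z /[!inE] -[Uy Vy] [Uz Vz] /=; rewrite -!iterS !iterSr => yz.
by apply: injU; rewrite ?inE//; apply: injV; rewrite ?inE.
Qed.

Lemma basic_cover : \bigcup_(i in basic_domain) basic_bisection i = setT.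
Proof.
rewrite -subTset => -[x m y [k [l [kl klm]]]] _.
have [U [oU Ux] iU] := iter_locally_injective k x.
have [V [oV Vy] iV] := iter_locally_injective l y.
by exists (U, V, k, l).
Qed.

Lemma basic_join i j g : basic_domain i -> basic_domain j ->
  basic_bisection i g -> basic_bisection j g ->
  exists p, [/\ basic_domain p, basic_bisection p g &
                basic_bisection p `<=` basic_bisection i `&` basic_bisection j].
Proof.
move: i j => [[[U V] k] l] [[[U' V'] k'] l'].
wlog kk' : U V k l U' V' k' l' / (k <= k')%N.
  move=> wl; have [kk'|/ltnW k'k] := leqP k k'; first exact: wl kk'.
  move=> Di Dj gi gj; have [p [Dp pg sp]] := wl _ _ _ _ _ _ _ _ k'k Dj Di gj gi.
  by exists p; rewrite setIC.
move=> [oU oV iU iV] [oU' oV' _ _] [Ug Vg dg eg] [U'g V'g dg' _].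
exists (U `&` U', V `&` V', k, l); split=> [||h [[Uh U'h] [Vh V'h] dh eh]].
- split; [exact: openI|exact: openI| |].
  + by move=> x y /[!inE] -[Ux _] [Uy _]; apply: iU; rewrite inE.
  + by move=> x y /[!inE] -[Vx _] [Vy _]; apply: iV; rewrite inE.
- by split.
- split; first by split.
  have klE : (k%:Z + l'%:Z = k'%:Z + l%:Z)%R.
    by apply/eqP; rewrite -subr_eq addrAC -dg dg' subrK.
  have {}klE : (k + l' = k' + l)%N by case: klE.
  split=> //; first by rewrite dh -dg.
  have -> : k' = ((k' - k) + k)%N by rewrite subnK.
  have -> : l' = ((k' - k) + l)%N.
    by apply/eqP; rewrite -(eqn_add2l k) klE addnA subnKC.
  by rewrite !iterD eh.
Qed.

HB.instance Definition _ :=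
  isBaseTopological.Build Gamma basic_cover basic_join.

Definition arrow_step (x : X) : Gamma := Arrow sigma_lh (tail_step sigma x).

End GroupoidTopology.

Section GammaSheaves.
Variables (X : topologicalType) (sigma : X -> X).
Variable sigma_lh : local_homeomorphism sigma.
Local Notation Gamma := (groupoid sigma_lh).

(* The action is defined on the pairs (g, a) with a in the stalk at src g,
   topologized as a subspace of Gamma * etale A. *)
Section ActionDomain.
Variables (A : sheaf X) (act : forall g : Gamma, {additive A (src g) -> A (rng g)}).

Definition action_domain : choiceType := {g : Gamma & A (src g)}.

Definition action_domain_pair (u : action_domain) : Gamma * etale A :=
  (projT1 u, etale_pt (projT2 u)).

Definition action_total (u : action_domain) : etale A :=
  etale_pt (act (projT1 u) (projT2 u)).

End ActionDomain.

Record gamma_sheaf := GammaSheaf {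
  gsheaf :> sheaf X;
  act : forall g : Gamma, {additive gsheaf (src g) -> gsheaf (rng g)};
  act_bij : forall g, bijective (act g);
  act_unit : forall x (a : gsheaf x), act (Arrow sigma_lh (tail_unit sigma x)) a = a;
  act_comp : forall x m y n z (p : tail_equiv sigma x m y)
      (q : tail_equiv sigma y n z) (a : gsheaf z),
    act (Arrow sigma_lh (tail_comp p q)) a =
    act (Arrow sigma_lh p) (act (Arrow sigma_lh q) a);
  act_cont : continuous
    (action_total act : initial_topology (@action_domain_pair gsheaf) -> _) }.

Record gamma_hom (A B : gamma_sheaf) := GammaHom {
  gamma_hom_sheaf :> sheaf_hom A B;
  gamma_hom_act : forall (g : Gamma) (a : A (src g)),
    gamma_hom_sheaf (rng g) (act A g a) = act B g (gamma_hom_sheaf (src g) a) }.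

Definition injective_gamma_sheaf (J : gamma_sheaf) : Prop :=
  forall (A B : gamma_sheaf) (i : gamma_hom A B) (f : gamma_hom A J),
    stalkwise_injective i ->
    exists g : gamma_hom B J, forall x a, g x (i x a) = f x a.

Record gamma_complex := GammaComplex {
  gcobj :> nat -> gamma_sheaf;
  gcd : forall n, gamma_hom (gcobj n) (gcobj n.+1);
  gcdd : forall n x a, gcd n.+1 x (gcd n x a) = 0 }.

Definition underlying_complex (Q : gamma_complex) : sheaf_complex X :=
  @SheafComplex X (fun n => Q n) (fun n => gcd Q n) (@gcdd Q).

Record injective_gamma_resolution (A : gamma_sheaf) :=
  InjectiveGammaResolution {
    gires :> gamma_complex;
    gires_aug : gamma_hom A (gires 0%N);
    gires_exact :
      @is_resolution X A (underlying_complex gires) gires_aug;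
    gires_inj : forall n, injective_gamma_sheaf (gires n) }.

Section Cocycles.
Variable A : gamma_sheaf.

Record cocycle := Cocycle {
  coc :> forall g : Gamma, A (rng g);
  coc_cont : continuous (fun g => etale_pt (coc g));
  coc_comp : forall x m y n z (p : tail_equiv sigma x m y)
      (q : tail_equiv sigma y n z),
    coc (Arrow sigma_lh (tail_comp p q)) =
    coc (Arrow sigma_lh p) + act A (Arrow sigma_lh p) (coc (Arrow sigma_lh q)) }.

Lemma cocycle_ext (s t : cocycle) : (forall g, s g = t g) -> s = t.
Proof.
case: s t => [s cs ms] [t ct mt] /= st.
have est : s = t by exact: functional_extensionality_dep.
by case: _ / est in ct mt *; congr Cocycle; exact: Prop_irrelevance.
Qed.

HB.instance Definition _ := gen_eqMixin cocycle.
HB.instance Definition _ := gen_choiceMixin cocycle.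

Lemma rng_continuous : continuous (@rng X sigma sigma_lh).
Proof.
apply/continuousP => U oU; rewrite openE => -[x m y [k [l [kl klm]]]] /= Ux.
have [V [oV Vx] iV] := iter_locally_injective sigma_lh k x.
have [W [oW Wy] iW] := iter_locally_injective sigma_lh l y.
rewrite /interior nbhsE /=.
pose i : basic_index X := (U `&` V, W, k, l).
exists (@basic_bisection _ _ sigma_lh i); last by move=> g [[]].
split; last by split.
exists [set i]; last by rewrite bigcup_set1.
move=> _ ->; split=> //; first exact: openI.
by move=> a b /[!inE] -[_ Va] [_ Vb]; apply: iV; rewrite inE.
Qed.

Lemma coc0_comp x m y n z (p : tail_equiv sigma x m y)
    (q : tail_equiv sigma y n z) :
  0 = 0 + act A (Arrow sigma_lh p) 0 :> A x.
Proof. by rewrite raddf0 addr0. Qed.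

Definition coc0 : cocycle :=
  @Cocycle (fun g => 0) (etale_zero_continuous (A := A) rng_continuous) coc0_comp.

Lemma coc_opp_comp (f : cocycle) x m y n z (p : tail_equiv sigma x m y)
    (q : tail_equiv sigma y n z) :
  - f (Arrow sigma_lh (tail_comp p q)) =
  - f (Arrow sigma_lh p) + act A (Arrow sigma_lh p) (- f (Arrow sigma_lh q)).
Proof. by rewrite coc_comp raddfN opprD. Qed.

Definition coc_opp (f : cocycle) : cocycle :=
  @Cocycle (fun g => - f g) (etale_opp_continuous (@coc_cont f))
    (@coc_opp_comp f).

Lemma coc_add_comp (f h : cocycle) x m y n z (p : tail_equiv sigma x m y)
    (q : tail_equiv sigma y n z) :
  f (Arrow sigma_lh (tail_comp p q)) + h (Arrow sigma_lh (tail_comp p q)) =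
  f (Arrow sigma_lh p) + h (Arrow sigma_lh p) +
  act A (Arrow sigma_lh p) (f (Arrow sigma_lh q) + h (Arrow sigma_lh q)).
Proof. by rewrite !coc_comp raddfD addrACA. Qed.

Definition coc_add (f h : cocycle) : cocycle :=
  @Cocycle (fun g => f g + h g)
    (etale_add_continuous (@coc_cont f) (@coc_cont h)) (@coc_add_comp f h).

Lemma coc_addA : associative coc_add.
Proof. by move=> r s t; apply: cocycle_ext => x /=; rewrite addrA. Qed.
Lemma coc_addC : commutative coc_add.
Proof. by move=> s t; apply: cocycle_ext => x /=; rewrite addrC. Qed.
Lemma coc_add0 : left_id coc0 coc_add.
Proof. by move=> s; apply: cocycle_ext => x /=; rewrite add0r. Qed.
Lemma coc_addN : left_inverse coc0 coc_opp coc_add.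
Proof. by move=> s; apply: cocycle_ext => x /=; rewrite addNr. Qed.
HB.instance Definition _ := GRing.isZmodule.Build cocycle
  coc_addA coc_addC coc_add0 coc_addN.

Lemma arrow_step_continuous : continuous (arrow_step sigma_lh).
Proof.
apply/continuousP => _ [D DD <-]; rewrite preimage_bigcup.
apply: bigcup_open => i /DD; move: i => [[[U V] k] l] [oU oV _ _].
have [kl|kl] := pselect (1 = k%:Z - l%:Z); last first.
  by rewrite (_ : _ @^-1` _ = set0); [exact: open0|rewrite -subset0 => x []].
rewrite (_ : _ @^-1` _ = U `&` sigma @^-1` V).
  apply: openI => //.
  by move/continuousP: (sigma_continuous sigma_lh); exact.
apply/seteqP; split=> x [] // Ux Vx; split=> //=.
have -> : k = l.+1 by apply/eqP; rewrite -eqz_nat -addn1 PoszD addrC -subr_eq -kl.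
by rewrite iterSr.
Qed.

Lemma phi_cont (f : cocycle) :
  continuous (fun x => etale_pt (f (arrow_step sigma_lh x) : A x)).
Proof.
move=> x; pose F (g : Gamma) := etale_pt (f g).
exact: (@continuous_comp _ _ _ (arrow_step sigma_lh) F x
  (@arrow_step_continuous x) (@coc_cont f (arrow_step sigma_lh x))).
Qed.

Definition phi (f : cocycle) : global_section A := GlobalSection (@phi_cont f).

Lemma phi_additive : zmod_morphism phi.
Proof. by move=> f h; apply: global_section_ext. Qed.
HB.instance Definition _ := GRing.isZmodMorphism.Build
  cocycle (global_section A) phi phi_additive.

End Cocycles.

Section CocycleMap.
Variables (A B : gamma_sheaf) (h : gamma_hom A B).

Lemma cocycle_map_cont (f : cocycle A) :
  continuous (fun g : Gamma => etale_pt (h (rng g) (f g))).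
Proof.
move=> g; exact: (continuous_comp (@coc_cont _ f g)
  (@sheaf_hom_cont _ _ _ h (etale_pt (f g)))).
Qed.

Lemma cocycle_map_comp (f : cocycle A) x m y n z (p : tail_equiv sigma x m y)
    (q : tail_equiv sigma y n z) :
  h x (f (Arrow sigma_lh (tail_comp p q))) =
  h x (f (Arrow sigma_lh p)) +
  act B (Arrow sigma_lh p) (h y (f (Arrow sigma_lh q))).
Proof.
rewrite coc_comp raddfD; congr (_ + _).
exact: (gamma_hom_act h (g := Arrow sigma_lh p)).
Qed.

Definition cocycle_map (f : cocycle A) : cocycle B :=
  @Cocycle B (fun g => h (rng g) (f g)) (@cocycle_map_cont f)
    (@cocycle_map_comp f).

Lemma cocycle_map_additive : zmod_morphism cocycle_map.
Proof. by move=> s t; apply: cocycle_ext => x /=; rewrite raddfB. Qed.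
HB.instance Definition _ := GRing.isZmodMorphism.Build
  (cocycle A) (cocycle B) cocycle_map cocycle_map_additive.

End CocycleMap.

Lemma cocycle_complex_dd (Q : gamma_complex) n (f : cocycle (Q n)) :
  cocycle_map (gcd Q n.+1) (cocycle_map (gcd Q n) f) = 0.
Proof. by apply: cocycle_ext => g; exact: gcdd. Qed.

Definition cocycle_complex (Q : gamma_complex) : cochain_complex :=
  @CochainComplex (fun n => cocycle (Q n)) (fun n => cocycle_map (gcd Q n))
    (@cocycle_complex_dd Q).

Lemma phi_complex_d (Q : gamma_complex) n (f : cocycle (Q n)) :
  phi (cocycle_map (gcd Q n) f) = gsec_map (gcd Q n) (phi f).
Proof. by apply: global_section_ext. Qed.

Definition phi_complex (Q : gamma_complex) :
    cochain_map (cocycle_complex Q) (section_complex (underlying_complex Q)) :=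
  @CochainMap (cocycle_complex Q) (section_complex (underlying_complex Q))
    (fun n => @phi (Q n)) (@phi_complex_d Q).

(* The cohomology of cocycle_complex Q is the n-th derived functor of the cocycle
   functor at A, and that of section_complex J is H^n(X, A). A comparison is a
   chain map Q -> J of sheaves over the identity of A; it is unique up to
   homotopy and induces the canonical map from H^n(S(Q)) to H^n(X, A). *)
Section Comparison.
Variables (A : gamma_sheaf) (Q : injective_gamma_resolution A).
Variables (J : injective_resolution A).

Record comparison := Comparison {
  comparison_hom :> complex_hom (underlying_complex Q) J;
  comparison_aug : forall x (a : A x),
    comparison_hom 0%N x (gires_aug Q x a) = ires_aug J x a }.

Definition induced_phi (c : comparison) (n : nat) :
    {additive cohomology (cocycle_complex Q) n ->
              cohomology (section_complex J) n} :=
  @cohomology_map _ _ (section_complex_map c) n \o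
  @cohomology_map _ _ (phi_complex Q) n.

End Comparison.

End GammaSheaves.

(* Main.v *)
Require Import Defs.
From HB Require Import structures.
From mathcomp Require Import all_boot all_order all_algebra.
From mathcomp Require Import all_classical.
From mathcomp Require Import topology.

Set Implicit Arguments.
Unset Strict Implicit.
Unset Printing Implicit Defensive.

Import GRing.Theory.

Local Open Scope classical_set_scope.
Local Open Scope ring_scope.

(** The map phi is an isomorphism for every equivariant sheaf A, before any
    cohomology is taken. The arrows (x, 1, sigma x) generate the groupoid and
    satisfy no relation, so a cocycle is freely determined by its values on
    them: a section s extends to the cocycle whose value at (x, k - l, y) with
    sigma^k x = sigma^l y is P_k x - (x, k - l, y) P_l y, where P_k x is the
    sum of the (x, i, sigma^i x) s(sigma^i x) for i < k ([path_sum]). Replacing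
    (k, l) by (k + 1, l + 1) changes both terms by the same amount, and near any
    arrow one pair (k, l) serves all arrows, which gives continuity
    ([phi_bijective]). Hence the cocycle complex and the section complex of an
    injective equivariant resolution Q are isomorphic.

    It remains to see that the sections of Q compute the cohomology of X. This
    holds because forgetting the action preserves injectives
    ([injective_gamma_sheaf_forget]), the forgetful functor having a left adjoint
    L that preserves monomorphisms: the stalk of L B at x is the direct sum of
    the stalks of B at src g over the arrows g with rng g = x, and the groupoid
    acts by translation of the arrows. A morphism f from B to an equivariant Q
    corresponds to the equivariant morphism from L B to Q sending b in the
    summand of g to g (f b) ([desc]). To extend f : A -> Q along a monomorphism
    i : A -> B, extend the corresponding morphism on L A along L i, then compose
    with the unit of B.

    So Q and J are two resolutions of A by injective sheaves. A morphism of
    complexes over the identity of A is then a homotopy equivalence, and the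
    comparison induces an isomorphism on the cohomology of sections
    ([injective_resolutions_cohomology]).

    The sheaves needed on the way (images of morphisms, and L B) are described by
    their local sections: a class of total sections that are good at a point
    determines a topology on the total space under which it is a sheaf
    ([germ_sheaf]). *)

(** * Local homeomorphisms and their sections *)

Section LocalHomeomorphisms.
Implicit Types T U Y : topologicalType.

Lemma continuous_forP Y T (f : Y -> T) y :
  {for y, continuous f} <->
  (forall O, open O -> O (f y) -> \forall z \near y, O (f z)).
Proof.
split=> [cf O oO Ofy|cf A].
  by have := cf O (open_nbhs_nbhs (conj oO Ofy)).
rewrite nbhsE => -[O [oO Oy] OA].
by have := cf O oO Oy; apply: filterS => z /OA.
Qed.

Lemma continuous_for_near_eq Y T (f g : Y -> T) y :
  (\forall z \near y, f z = g z) -> {for y, continuous f} -> {for y, continuous g}.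
Proof.
move=> fg cf A; have /= <- := nbhs_singleton fg => /cf fA.
by apply: filterS2 fg fA => z; rewrite /preimage/= => <-.
Qed.

(** The section is a total function, given a junk value off the image of a
    neighbourhood of t, so that only its germ at f t matters. *)
Lemma local_homeomorphism_section T U (f : T -> U) (t : T) :
  local_homeomorphism f ->
  exists s : U -> T, s (f t) = t /\
    \forall y \near f t, f (s y) = y /\ {for y, continuous s}.
Proof.
move=> f_lh; have [V [oV Vt] [_ f_inj f_open]] := f_lh t.
pose s y := if pselect (exists2 v, V v & f v = y) is left e
            then projT1 (cid2 e) else t.
have sf v : V v -> s (f v) = v.
  rewrite /s => Vv; case: pselect => [e|[]]; last by exists v.
  by case: cid2 => w /= Vw fw; apply: f_inj; rewrite ?inE.
exists s; split; first exact: sf.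
have : nbhs (f t) (f @` V).
  by apply: open_nbhs_nbhs; split; [exact: f_open|exists t].
apply: filterS => _ [v Vv <-]; rewrite sf//; split=> // A.
rewrite sf// nbhsE => -[B [oB Bv] BA].
have : nbhs (f v) (f @` (B `&` V)).
  apply: open_nbhs_nbhs; split; last by exists v.
  by apply: f_open; [exact: subIsetr|exact: openI].
by apply: filterS => _ [w [Bw Vw] <-]; rewrite /preimage/= sf//; exact: BA.
Qed.

Lemma local_homeomorphism_continuous T U (f : T -> U) :
  local_homeomorphism f -> continuous f.
Proof.
by move=> f_lh t; have [V [_ Vt] [fV _ _]] := f_lh t; apply: fV; rewrite inE.
Qed.

Lemma local_homeomorphism_lift_unique T U Y (f : T -> U) (s s' : Y -> T) y :
  local_homeomorphism f ->
  {for y, continuous s} -> {for y, continuous s'} -> s y = s' y ->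
  (\forall z \near y, f (s z) = f (s' z)) -> \forall z \near y, s z = s' z.
Proof.
move=> f_lh cs cs' ss' fss'; have [V [oV Vt] [_ f_inj _]] := f_lh (s y).
have nV : nbhs (s y) V by exact: open_nbhs_nbhs.
have Vs : \forall z \near y, V (s z) by exact: cs.
have Vs' : \forall z \near y, V (s' z) by apply: cs'; rewrite -ss'.
by apply: filterS3 Vs Vs' fss' => z *; apply: f_inj; rewrite ?inE.
Qed.

Lemma local_homeomorphism_open T U (f : T -> U) (W : set T) :
  local_homeomorphism f -> open W -> open (f @` W).
Proof.
move=> f_lh oW; rewrite openE => _ [t Wt <-]; rewrite /interior.
have [V [oV Vt] [_ _ f_open]] := f_lh t.
apply: (@filterS _ _ _ (f @` (W `&` V))); first by move=> _ [w [Ww _] <-]; exists w.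
apply: open_nbhs_nbhs; split; last by exists t.
by apply: f_open; [exact: subIsetr|exact: openI].
Qed.

End LocalHomeomorphisms.

(** * Local sections of a sheaf *)

Lemma etale_pt_inj (X : topologicalType) (A : group_bundle X) x :
  injective (@etale_pt X A x).
Proof.
by move=> a b /eqP; rewrite /etale_pt -[existT _ x b]/(Tagged (fun y => A y) b) eq_Tagged => /eqP.
Qed.

Section LocalSections.
Variables (X : topologicalType) (A : sheaf X).

Section Along.
Variables (Y : topologicalType) (u : Y -> X).
Implicit Types (a b : forall y, A (u y)) (y : Y).

Lemma etale_opp_continuous_for a y :
  {for y, continuous (fun z => etale_pt (a z))} ->
  {for y, continuous (fun z => etale_pt (- a z))}.
Proof.
by move=> ca; exact: (continuous_comp ca (@sheaf_opp_cont X A (etale_pt (a y)))).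
Qed.

Lemma etale_add_continuous_for a b y :
  {for y, continuous (fun z => etale_pt (a z))} ->
  {for y, continuous (fun z => etale_pt (b z))} ->
  {for y, continuous (fun z => etale_pt (a z + b z))}.
Proof.
move=> ca cb.
pose w z : initial_topology (@fibre_square_pair X A) :=
  existT (fun x => (A x * A x)%type) (u z) (a z, b z).
have cw : {for y, continuous w}.
  have cab : {for y, continuous (fun z => (etale_pt (a z), etale_pt (b z)))}.
    exact: (cvg_pair ca cb).
  by apply/continuous_forP => _ [O oO <-]; move/continuous_forP: cab; exact.
exact: (continuous_comp cw (@sheaf_add_cont X A (w y))).
Qed.

Lemma etale_sub_continuous_for a b y :
  {for y, continuous (fun z => etale_pt (a z))} ->
  {for y, continuous (fun z => etale_pt (b z))} ->
  {for y, continuous (fun z => etale_pt (a z - b z))}.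
Proof.
move=> ca cb.
exact: (etale_add_continuous_for ca (etale_opp_continuous_for cb)).
Qed.

Lemma etale_zero_continuous_for y : {for y, continuous u} ->
  {for y, continuous (fun z => etale_pt (0 : A (u z)))}.
Proof.
by move=> cu; exact: (continuous_comp cu (@sheaf_zero_cont X A (u y))).
Qed.

Lemma etale_eq_near a b y :
  {for y, continuous (fun z => etale_pt (a z))} ->
  {for y, continuous (fun z => etale_pt (b z))} ->
  a y = b y -> \forall z \near y, a z = b z.
Proof.
move=> ca cb ab.
have h : \forall z \near y, etale_pt (a z) = etale_pt (b z) :> etale A.
  apply: (local_homeomorphism_lift_unique (@sheaf_local_homeo X A) ca cb).
    by rewrite ab.
  exact: nearW.
by apply: filterS h => z; exact: etale_pt_inj.
Qed.

End Along.

(** Sections near x are represented by functions on the whole of X, zero where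
    the etale space gives no value; continuity is claimed only near x. *)
Lemma local_section_ex x (a : A x) : exists2 s : forall y, A y, s x = a &
  \forall y \near x, {for y, continuous (fun z => etale_pt (s z))}.
Proof.
have [e [ex ne]] :=
  local_homeomorphism_section (etale_pt a) (@sheaf_local_homeo X A).
pose s y : A y := if pselect (etale_proj (e y) = y) is left E
                  then eq_rect _ (stalk A) (projT2 (e y)) _ E else 0.
have se y : etale_proj (e y) = y -> etale_pt (s y) = e y.
  rewrite /s; case: pselect => // E _; case: (e y) E => z b /= E.
  by case: _ / E.
exists s; first by apply: (@etale_pt_inj X A); rewrite se ex.
have nse : \forall y \near x, e y = etale_pt (s y).
  by apply: filterS ne => y [ey _]; rewrite se.
apply: filterS2 (near_join nse) ne => y eqy [_ ce].
exact: continuous_for_near_eq eqy ce.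
Qed.

End LocalSections.

(** * Sheaves presented by germs *)

(** [good x s] stands for: s is a section on some neighbourhood of x. The local
    sections are total functions, which keeps their domains out of the
    statements, and the axioms are those of the sheaf of germs: openness, a
    section through every point, uniqueness of germs, and group structure. *)
Record germs (X : topologicalType) (S : X -> zmodType) := Germs {
  good : X -> (forall y, S y) -> Prop;
  good_near : forall x s, good x s -> \forall y \near x, good y s;
  good_ex : forall x (a : S x), exists2 s, good x s & s x = a;
  good_eq0 : forall x s, good x s -> s x = 0 -> \forall y \near x, s y = 0;
  good_sub : forall x s t, good x s -> good x t -> good x (fun y => s y - t y) }.

Section GermSheaf.
Variables (X : topologicalType) (S : X -> zmodType) (G : germs S).
Implicit Types (x y : X) (s t : forall y, S y).
Local Notation good := (good G).
Local Notation pt s y := (existT S y (s y)).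

(** The final topology for the good sections. *)
Definition germ_open (O : set (total_space S)) : Prop :=
  forall x s, good x s -> O (pt s x) -> \forall y \near x, O (pt s y).

Lemma germ_openT : germ_open setT.
Proof. by move=> x s _ _; exact: nearW. Qed.

Lemma germ_openI : setI_closed germ_open.
Proof.
move=> O P oO oP x s gs [Os Ps].
exact: filterI (oO _ _ gs Os) (oP _ _ gs Ps).
Qed.

Lemma germ_open_bigcup (I : Type) (F : I -> set (total_space S)) :
  (forall i, germ_open (F i)) -> germ_open (\bigcup_i F i).
Proof.
move=> oF x s gs [i _ Fis].
by apply: filterS (oF i _ _ gs Fis) => y; exists i.
Qed.

Definition germ_bundle : group_bundle X :=
  @GroupBundle X S
    (isOpenTopological.Build (total_space S) germ_openT germ_openI germ_open_bigcup).

Lemma good_add x s t : good x s -> good x t -> good x (fun y => s y + t y).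
Proof.
move=> gs gt; have := good_sub gs (good_sub (good_sub gs gs) gt).
congr (good x _); apply: functional_extensionality_dep => y.
by rewrite subrr sub0r opprK.
Qed.

Lemma good0 x : good x (fun=> 0).
Proof.
have [s gs _] := good_ex G (0 : S x); have := good_sub gs gs.
congr (good x _); apply: functional_extensionality_dep => y.
exact: subrr.
Qed.

Lemma good_opp x s : good x s -> good x (fun y => - s y).
Proof.
move=> gs; have := good_sub (good0 x) gs.
by congr (good x _); apply: functional_extensionality_dep => y; rewrite sub0r.
Qed.

Lemma good_eq_near x s t : good x s -> good x t -> s x = t x ->
  \forall y \near x, s y = t y.
Proof.
move=> gs gt st; have := good_eq0 (good_sub gs gt).
rewrite st subrr => /(_ erefl); apply: filterS => y /eqP.
by rewrite subr_eq0 => /eqP.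
Qed.

Local Notation E := (etale germ_bundle).
Local Notation germ_pt := (@etale_pt X germ_bundle _).

Lemma germ_openE (O : set E) : open O = germ_open O.
Proof. by []. Qed.

Lemma good_continuous x s : good x s ->
  {for x, continuous (fun y => germ_pt (s y))}.
Proof. by move=> gs; apply/continuous_forP => O oO; exact: oO. Qed.

(** The images of good sections over open sets form a basis of the topology;
    restricting to the points where s is good makes them open. *)
Definition germ_image (U : set X) s : set E :=
  [set e | [/\ U (projT1 e), good (projT1 e) s & projT2 e = s (projT1 e)]].

Lemma germ_image_open U s : open U -> open (germ_image U s).
Proof.
move=> oU; rewrite germ_openE => x t gt [/= Ux gs st].
have nU : nbhs x U by exact: open_nbhs_nbhs.
by apply: filterS3 nU (good_near gs) (good_eq_near gt gs st).
Qed.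

Lemma germ_proj_continuous : continuous (@etale_proj X germ_bundle).
Proof.
move=> e; apply/continuous_forP => O oO Oe.
have oP : open (@etale_proj X germ_bundle @^-1` O).
  by rewrite germ_openE => x s gs Ox; exact: open_nbhs_nbhs.
exact: (open_nbhs_nbhs (conj oP Oe)).
Qed.

Lemma germ_local_homeo : local_homeomorphism (@etale_proj X germ_bundle).
Proof.
move=> [x a]; have [s gs sx] := good_ex G a.
exists (germ_image setT s).
  by split; [apply: germ_image_open; exact: openT|split].
split=> [e _|[y b] [z c]|W sW oW].
- exact: germ_proj_continuous.
- rewrite !inE => -[/= _ _ ->] [/= _ _ ->] yz.
  by rewrite /etale_proj/= in yz; rewrite yz.
- rewrite openE => _ [[y b] Wy <-]; have [/= _ gy bE] := sW _ Wy.
  rewrite bE in Wy; have := oW _ _ gy Wy.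
  by apply: filterS => z Wz; exists (germ_pt (s z)).
Qed.

(** One good section through a point tests continuity there, because it is a
    local inverse of the projection. *)
Lemma germ_continuous_for (T : topologicalType) (F : E -> T) x s : good x s ->
  {for x, continuous (fun y => F (germ_pt (s y)))} ->
  {for germ_pt (s x), continuous F}.
Proof.
move=> gs cF; apply/continuous_forP => O oO Ox.
move/continuous_forP/(_ O oO Ox) : cF; rewrite /prop_near1/= nbhsE => -[U [oU Ux] UO].
have : nbhs (germ_pt (s x)) (germ_image U s).
  by apply: open_nbhs_nbhs; split; [exact: germ_image_open|split].
by apply: filterS => -[y b] [/= Uy _ ->]; exact: UO.
Qed.

Lemma germ_zero_continuous :
  continuous (fun x => etale_pt (0 : germ_bundle x)).
Proof. by move=> x; exact: (good_continuous (good0 x)). Qed.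

Lemma germ_opp_continuous : continuous (fun e : E => etale_pt (- projT2 e)).
Proof.
move=> [x a]; have [s gs <-] := good_ex G a.
exact: (germ_continuous_for gs (good_continuous (good_opp gs))).
Qed.

Lemma germ_add_continuous :
  continuous (@fibre_square_add X germ_bundle :
                initial_topology (@fibre_square_pair X germ_bundle) -> _).
Proof.
move=> [x [a b]]; have [s gs <-] := good_ex G a; have [t gt <-] := good_ex G b.
apply/continuous_forP => O oO; rewrite /fibre_square_add/= => Ox.
have := oO _ _ (good_add gs gt) Ox; rewrite /prop_near1/= nbhsE => -[U [oU Ux] UO].
apply: (@filterS _ _ _ (@fibre_square_pair X germ_bundle @^-1`
  (germ_image U s `*` germ_image U t))).
  move=> [y [c d]] [/= [/= Uy _ cE] [/= _ _ dE]].
  by rewrite /fibre_square_add/= cE dE; exact: UO.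
apply: (@initial_continuous _ _ (@fibre_square_pair X germ_bundle)).
exists (germ_image U s, germ_image U t) => //.
by split; apply: open_nbhs_nbhs; (split; [exact: germ_image_open|split]).
Qed.

Definition germ_sheaf : sheaf X :=
  Sheaf germ_local_homeo germ_zero_continuous germ_opp_continuous
    germ_add_continuous.

End GermSheaf.

(** * Morphisms into injective sheaves *)

Section Homs.
Variable X : topologicalType.
Implicit Types A B C : sheaf X.

Lemma sheaf_hom_continuous_for A B (f : sheaf_hom A B) (Y : topologicalType)
    (u : Y -> X) (a : forall y, A (u y)) (y : Y) :
  {for y, continuous (fun z => etale_pt (a z))} ->
  {for y, continuous (fun z => etale_pt (f (u z) (a z)))}.
Proof.
by move=> ca; exact: (continuous_comp ca (@sheaf_hom_cont _ _ _ f (etale_pt (a y)))).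
Qed.

Arguments sheaf_hom_continuous_for {A B} f {Y u a y} ca.

Lemma hom_id_cont A :
  continuous (fun e : etale A => etale_pt (idfun (projT2 e) : A (projT1 e))).
Proof.
suff -> : (fun e : etale A => etale_pt (idfun (projT2 e) : A (projT1 e))) = id.
  by move=> e; exact: cvg_id.
by apply: functional_extensionality_dep => -[].
Qed.

Definition hom_id A : sheaf_hom A A :=
  @SheafHom X A A (fun x => idfun) (@hom_id_cont A).

Lemma hom_comp_cont A B C (g : sheaf_hom B C) (f : sheaf_hom A B) :
  continuous (fun e : etale A => etale_pt ((g _ \o f _) (projT2 e))).
Proof.
move=> e; exact: (@sheaf_hom_continuous_for _ _ g _ _
  (fun e : etale A => f _ (projT2 e)) _ (@sheaf_hom_cont _ _ _ f e)).
Qed.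

Definition hom_comp A B C (g : sheaf_hom B C) (f : sheaf_hom A B) :
    sheaf_hom A C :=
  @SheafHom X A C (fun x => g x \o f x) (@hom_comp_cont A B C g f).

Lemma hom_sub_cont A B (f g : sheaf_hom A B) :
  continuous (fun e : etale A => etale_pt ((f _ \- g _) (projT2 e))).
Proof.
move=> e.
exact: (@etale_sub_continuous_for _ _ _ _ (fun e : etale A => f _ (projT2 e))
  (fun e : etale A => g _ (projT2 e)) _
  (@sheaf_hom_cont _ _ _ f e) (@sheaf_hom_cont _ _ _ g e)).
Qed.

Definition hom_sub A B (f g : sheaf_hom A B) : sheaf_hom A B :=
  @SheafHom X A B (fun x => f x \- g x) (@hom_sub_cont A B f g).

End Homs.
Arguments sheaf_hom_continuous_for {X A B} f {Y u a y} ca.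

(** The image is a group of its own, to serve as the stalk of the image sheaf. *)
Section AdditiveImage.
Variables (U V : zmodType) (f : {additive U -> V}).

Definition in_image : {pred V} := fun v => `[< exists u, f u = v >].

Lemma in_image_zmod : zmod_closed in_image.
Proof.
split=> [|_ _ /asboolP[u <-] /asboolP[v <-]]; apply/asboolP.
  by exists 0; rewrite raddf0.
by exists (u - v); rewrite raddfB.
Qed.
HB.instance Definition _ := GRing.isZmodClosed.Build V in_image in_image_zmod.

Record image_zmod := ImageZmod { image_val : V; _ : in_image image_val }.
HB.instance Definition _ := [isSub for image_val].
HB.instance Definition _ := [Choice of image_zmod by <:].
HB.instance Definition _ := [SubChoice_isSubZmodule of image_zmod by <:].

Lemma in_image_map u : in_image (f u).
Proof. by apply/asboolP; exists u. Qed.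

Definition to_image u : image_zmod := ImageZmod (in_image_map u).

Lemma to_image_surj (v : image_zmod) : exists u, v = to_image u.
Proof.
by case: v => v vP; have [u uv] := asboolP _ vP; exists u; apply: val_inj.
Qed.

End AdditiveImage.

Section ImageSheaf.
Variables (X : topologicalType) (B C : sheaf X) (h : sheaf_hom B C).

Let S x : zmodType := image_zmod (h x).

Definition image_good (x : X) (s : forall y, S y) : Prop :=
  \forall y \near x, {for y, continuous (fun z => etale_pt (val (s z) : C z))}.

Lemma image_good_map x (b : forall y, B y) :
  (\forall y \near x, {for y, continuous (fun z => etale_pt (b z))}) ->
  image_good x (fun y => to_image (h y) (b y)).
Proof. by apply: filterS => y; exact: sheaf_hom_continuous_for. Qed.

Lemma image_good_ex x (a : S x) : exists2 s, image_good x s & s x = a.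
Proof.
have [b ->] := to_image_surj a; have [s <- cs] := local_section_ex b.
by exists (fun y => to_image (h y) (s y)); first exact: image_good_map.
Qed.

Lemma image_good_eq0 x s : image_good x s -> s x = 0 -> \forall y \near x, s y = 0.
Proof.
move=> /nbhs_singleton cs sx0.
have c0 : {for x, continuous (fun y => etale_pt (0 : C y))}.
  exact: etale_zero_continuous_for.
have sx : val (s x) = 0 by rewrite sx0.
by apply: filterS (etale_eq_near cs c0 sx) => y sy; exact: val_inj.
Qed.

Lemma image_good_sub x s t :
  image_good x s -> image_good x t -> image_good x (fun y => s y - t y).
Proof. by apply: filterS2 => y; exact: etale_sub_continuous_for. Qed.

Definition image_germs : germs S :=
  @Germs X S image_good (fun x s => @near_join X x _) image_good_ex image_good_eq0
    image_good_sub.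

Definition image_sheaf : sheaf X := germ_sheaf image_germs.

Lemma image_incl_cont : continuous (fun e : etale image_sheaf =>
  etale_pt (val (projT2 e : S (projT1 e)) : C (projT1 e))).
Proof.
move=> [x a]; have [s gs <-] := image_good_ex a.
exact: (@germ_continuous_for _ _ image_germs _ _ _ _ gs (nbhs_singleton gs)).
Qed.

Definition image_incl : sheaf_hom image_sheaf C :=
  @SheafHom X image_sheaf C (fun x => (val : S x -> C x)) image_incl_cont.

Variables (J : sheaf X) (f : sheaf_hom B J).
Hypothesis f_ker : forall x b, h x b = 0 -> f x b = 0.

Definition image_desc_fun x (c : S x) : J x := f x (projT1 (cid (to_image_surj c))).

Lemma image_desc_funE x b : image_desc_fun (to_image (h x) b) = f x b.
Proof.
rewrite /image_desc_fun; case: cid => b' /= /(congr1 val)/= hb.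
apply/eqP; rewrite eq_sym -subr_eq0 -raddfB; apply/eqP/f_ker.
by rewrite raddfB hb subrr.
Qed.

Lemma image_desc_zmod_morphism x : zmod_morphism (@image_desc_fun x).
Proof.
move=> c c'; have [b ->] := to_image_surj c; have [b' ->] := to_image_surj c'.
rewrite !image_desc_funE -raddfB -image_desc_funE; congr image_desc_fun.
by apply: val_inj; rewrite /= raddfB.
Qed.
HB.instance Definition _ x := GRing.isZmodMorphism.Build (S x) (J x)
  (@image_desc_fun x) (@image_desc_zmod_morphism x).

Lemma image_desc_cont : continuous (fun e : etale image_sheaf =>
  etale_pt (image_desc_fun (projT2 e : S (projT1 e)))).
Proof.
move=> [x a]; have [b ->] := to_image_surj a; have [s <- cs] := local_section_ex b.
apply: (@germ_continuous_for _ _ image_germs _ _ _ _ (image_good_map cs)).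
have := sheaf_hom_continuous_for f (nbhs_singleton cs).
by apply: continuous_for_near_eq; apply: nearW => y; rewrite /= image_desc_funE.
Qed.

Definition image_desc : sheaf_hom image_sheaf J :=
  @SheafHom X image_sheaf J (fun x => @image_desc_fun x) image_desc_cont.

End ImageSheaf.

(** The form in which injectivity is used: f descends to the image sheaf of h,
    which is a subsheaf of C, and extends from there. *)
Lemma injective_sheaf_factor (X : topologicalType) (B C J : sheaf X)
    (h : sheaf_hom B C) (f : sheaf_hom B J) : injective_sheaf J ->
  (forall x b, h x b = 0 -> f x b = 0) ->
  exists g : sheaf_hom C J, forall x b, g x (h x b) = f x b.
Proof.
move=> J_inj f_ker.
have [|g gE] := J_inj _ _ (image_incl h) (image_desc f_ker).
  by move=> x a b /val_inj.
exists g => x b; have := gE x (to_image (h x) b).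
by rewrite /= image_desc_funE.
Qed.

(** * Comparison of injective resolutions *)

(** Morphisms of complexes and homotopies are built degree by degree; R records
    how the choice in degree n + 1 depends on the one in degree n. *)
Lemma dependent_choice_seq (T : nat -> Type) (R : forall n, T n -> T n.+1 -> Prop)
    (t0 : T 0%N) : (forall n t, exists t', R n t t') ->
  exists2 u : forall n, T n, u 0%N = t0 & forall n, R n (u n) (u n.+1).
Proof.
move=> step; pose next n t := projT1 (cid (step n t)).
by exists (nat_rect T t0 next) => // n; rewrite /= /next; case: cid.
Qed.

Section Complexes.
Variable X : topologicalType.
Implicit Types (A : sheaf X) (P I : sheaf_complex X).

Lemma injective_complex_lift A P I (e : sheaf_hom A (P 0%N))
    (i : sheaf_hom A (I 0%N)) : is_resolution e ->
  (forall x a, scd I 0 x (i x a) = 0) -> (forall n, injective_sheaf (I n)) ->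
  exists f : complex_hom P I, forall x a, f 0%N x (e x a) = i x a.
Proof.
move=> [e_inj exA exP] di I_inj.
(* A state holds two consecutive components, so that commutation with the
   differential is a property of the state alone. *)
pose T n := {p : sheaf_hom (P n) (I n) * sheaf_hom (P n.+1) (I n.+1) |
  forall x a, p.2 x (scd P n x a) = scd I n x (p.1 x a)}.
have [f0 f0E] : exists f0 : sheaf_hom (P 0%N) (I 0%N),
    forall x a, f0 x (e x a) = i x a.
  apply: injective_sheaf_factor => // x a ea; have -> : a = 0.
    by apply: (e_inj x); rewrite ea raddf0.
  by rewrite raddf0.
have [f1 f1E] : exists f1 : sheaf_hom (P 1%N) (I 1%N),
    forall x a, f1 x (scd P 0 x a) = hom_comp (scd I 0) f0 x a.
  apply: injective_sheaf_factor => // x a /exA[b <-] /=.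
  by rewrite f0E di.
pose t0 : T 0%N := exist _ (f0, f1) f1E.
pose R n (t : T n) (t' : T n.+1) := (sval t').1 = (sval t).2.
have [|u u0 uR] := @dependent_choice_seq T R t0.
  move=> n [[f f'] /= fE].
  have [f'' f''E] : exists f'' : sheaf_hom (P n.+2) (I n.+2),
      forall x a, f'' x (scd P n.+1 x a) = hom_comp (scd I n.+1) f' x a.
    apply: injective_sheaf_factor => // x a /exP[b <-] /=.
    by rewrite fE scdd.
  by exists (exist _ (f', f'') f''E).
have uE n x a : (sval (u n.+1)).1 x (scd P n x a) = scd I n x ((sval (u n)).1 x a).
  by rewrite uR; exact: (proj2_sig (u n)).
by exists (ComplexHom uE) => x a; rewrite /= u0 f0E.
Qed.

Lemma injective_complex_homotopy A P I (e : sheaf_hom A (P 0%N))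
    (f : complex_hom P I) : is_resolution e ->
  (forall x a, f 0%N x (e x a) = 0) -> (forall n, injective_sheaf (I n)) ->
  exists2 s : forall n, sheaf_hom (P n.+1) (I n),
    forall x a, f 0%N x a = s 0%N x (scd P 0 x a) &
    forall n x a, f n.+1 x a = s n.+1 x (scd P n.+1 x a) + scd I n x (s n x a).
Proof.
move=> [_ exA exP] fe I_inj.
(* What the construction of s_(n+1) needs of s_n is exactly that
   f_(n+1) - d s_n vanishes on the image of d, that is, on the kernel of d. *)
pose T n := {s : sheaf_hom (P n.+1) (I n) |
  forall x a, scd I n x (s x (scd P n x a)) = scd I n x (f n x a)}.
have [s0 s0E] : exists s0 : sheaf_hom (P 1%N) (I 0%N),
    forall x a, s0 x (scd P 0 x a) = f 0%N x a.
  by apply: injective_sheaf_factor => // x a /exA[b <-].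
have t0P x a : scd I 0 x (s0 x (scd P 0 x a)) = scd I 0 x (f 0%N x a).
  by rewrite s0E.
pose R n (t : T n) (t' : T n.+1) := forall x a,
  f n.+1 x a = sval t' x (scd P n.+1 x a) + scd I n x (sval t x a).
have [|u u0 uR] := @dependent_choice_seq T R (exist _ s0 t0P).
  move=> n [s /= sE].
  have [s' s'E] : exists s' : sheaf_hom (P n.+2) (I n.+1), forall x a,
      s' x (scd P n.+1 x a) = hom_sub (f n.+1) (hom_comp (scd I n) s) x a.
    apply: injective_sheaf_factor => // x a /exP[b <-] /=.
    by rewrite chomd sE subrr.
  have tP x a : scd I n.+1 x (s' x (scd P n.+1 x a)) = scd I n.+1 x (f n.+1 x a).
    by rewrite s'E /= raddfB scdd subr0.
  by exists (exist _ s' tP) => x a; rewrite /= s'E /= subrK.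
exists (fun n => sval (u n)) => [x a|n x a]; last exact: uR.
by rewrite u0 /= s0E.
Qed.

Lemma complex_comp_d P I (R : sheaf_complex X) (g : complex_hom I R)
    (f : complex_hom P I) n x (a : P n x) :
  hom_comp (g n.+1) (f n.+1) x (scd P n x a) =
  scd R n x (hom_comp (g n) (f n) x a).
Proof. by rewrite /= !chomd. Qed.

Definition complex_comp P I R (g : complex_hom I R) (f : complex_hom P I) :
    complex_hom P R := ComplexHom (complex_comp_d g f).

Lemma complex_sub_id_d P (f : complex_hom P P) n x (a : P n x) :
  hom_sub (f n.+1) (hom_id _) x (scd P n x a) =
  scd P n x (hom_sub (f n) (hom_id _) x a).
Proof. by rewrite /= chomd raddfB. Qed.

Definition complex_sub_id P (f : complex_hom P P) : complex_hom P P :=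
  ComplexHom (complex_sub_id_d f).

(** An endomorphism of an injective resolution over the identity is homotopic to
    the identity; on sections, the homotopy exhibits the boundary. *)
Lemma section_cycle_sub_boundary A P (e : sheaf_hom A (P 0%N)) (f : complex_hom P P) n
    (z : global_section (P n)) :
  is_resolution e -> (forall n, injective_sheaf (P n)) ->
  (forall x a, f 0%N x (e x a) = e x a) -> gsec_map (scd P n) z = 0 ->
  @is_boundary (section_complex P) n (gsec_map (f n) z - z).
Proof.
move=> e_res P_inj fe dz.
have dzE x : scd P n x (z x) = 0 by have := congr1 (fun t => gsec t x) dz.
have [|s s0 sS] := injective_complex_homotopy (f := complex_sub_id f) e_res _ P_inj.
  by move=> x a; rewrite /= fe subrr.
case: n z dz dzE => [|n] z _ dzE /=.
  by apply: global_section_ext => x; have /= -> := s0 x (z x); rewrite dzE raddf0.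
exists (gsec_map (s n) z); apply: global_section_ext => x /=.
by have /= -> := sS n x (z x); rewrite dzE raddf0 add0r.
Qed.

End Complexes.

Lemma gsec_map_comp (X : topologicalType) (A B C : sheaf X) (g : sheaf_hom B C)
    (f : sheaf_hom A B) (s : global_section A) :
  gsec_map (hom_comp g f) s = gsec_map g (gsec_map f s).
Proof. exact: global_section_ext. Qed.

Lemma cohomology_class_eq (C : cochain_complex) n (z w : cycles C n) :
  cohomology_class z = cohomology_class w <-> is_boundary (val z - val w).
Proof.
rewrite -(raddfB (val : cycles C n -> C n)) /cohomology_class.
split=> [/eqP|zw]; last apply/eqP; rewrite -Quotient.idealrBE unfold_in.
  by move/asboolP.
exact/asboolP.
Qed.

Lemma cohomology_class_surj (C : cochain_complex) n (a : cohomology C n) :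
  exists z, a = cohomology_class z.
Proof. by exists (repr a); rewrite /cohomology_class reprK. Qed.

Lemma inj_surj_bij (U V : Type) (f : U -> V) :
  injective f -> (forall v, exists u, v = f u) -> bijective f.
Proof.
move=> f_inj f_surj; pose g v := projT1 (cid (f_surj v)).
have gK : cancel g f by move=> v; rewrite /g; case: cid.
by exists g => // u; apply: f_inj; rewrite gK.
Qed.

Lemma cohomology_map_bij_degreewise (C D : cochain_complex) (f : cochain_map C D) n :
  (forall k, bijective (f k)) -> bijective (@cohomology_map _ _ f n).
Proof.
move=> f_bij; have f_inj k : injective (f k) := bij_inj (f_bij k).
have f_surj k v : exists u, v = f k u.
  by have [g _ gK] := f_bij k; exists (g v).
apply: inj_surj_bij => [a b|d].
  have [z ->] := cohomology_class_surj a; have [w ->] := cohomology_class_surj b.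
  rewrite !cohomology_mapE !cohomology_class_eq /= -raddfB.
  case: n z w {a b} => [|n] z w /= => [h|[d dE]].
    by apply: (f_inj 0%N); rewrite h raddf0.
  have [c cE] := f_surj n d; exists c.
  by apply: (f_inj n.+1); rewrite cmapd -cE.
have [w ->] := cohomology_class_surj d; have [c cE] := f_surj n (val w).
have zP : is_cycle c.
  apply/eqP; apply: (f_inj n.+1); rewrite cmapd -cE raddf0.
  by apply/eqP; case: (w).
exists (cohomology_class (Cycle zP)); rewrite cohomology_mapE.
by congr cohomology_class; apply: val_inj.
Qed.

(** A lift of the identity of A in the other direction is inverse to f up to
    homotopy, hence inverse on cohomology. *)
Lemma injective_resolutions_cohomology (X : topologicalType) (A : sheaf X)
    (I J : injective_resolution A) (f : complex_hom I J) n :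
  (forall x a, f 0%N x (ires_aug I x a) = ires_aug J x a) ->
  bijective (@cohomology_map _ _ (section_complex_map f) n).
Proof.
move=> fE; have J_d x a : scd I 0 x (ires_aug I x a) = 0.
  have [_ ex _] := ires_exact I.
  by apply/ex; exists a.
have [g gE] := injective_complex_lift (ires_exact J) J_d (@ires_inj _ _ I).
have cyc (K : injective_resolution A) (z : cycles (section_complex K) n) :
    gsec_map (scd K n) (val z) = 0 by apply/eqP; case: (z).
have gf (z : cycles (section_complex I) n) :
    @is_boundary (section_complex I) n
      (gsec_map (g n) (gsec_map (f n) (val z)) - val z).
  rewrite -gsec_map_comp; apply: (section_cycle_sub_boundary (f := complex_comp g f)
    (ires_exact I) (@ires_inj _ _ I) _ (cyc I z)).
  by move=> x a; rewrite /= fE gE.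
have fg (z : cycles (section_complex J) n) :
    @is_boundary (section_complex J) n
      (gsec_map (f n) (gsec_map (g n) (val z)) - val z).
  rewrite -gsec_map_comp; apply: (section_cycle_sub_boundary (f := complex_comp f g)
    (ires_exact J) (@ires_inj _ _ J) _ (cyc J z)).
  by move=> x a; rewrite /= gE fE.
pose F := @cohomology_map _ _ (section_complex_map f) n.
pose H := @cohomology_map _ _ (section_complex_map g) n.
exists H => a; have [w ->] := cohomology_class_surj a.
  by rewrite /H /F !cohomology_mapE; apply/cohomology_class_eq; exact: gf.
by rewrite /H /F !cohomology_mapE; apply/cohomology_class_eq; exact: fg.
Qed.

(** * The topology of the groupoid *)

Section GroupoidStructure.
Variables (X : topologicalType) (sigma : X -> X).
Variable sigma_lh : local_homeomorphism sigma.
Local Notation Gamma := (groupoid sigma_lh).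
Local Notation bisection := (@basic_bisection X sigma sigma_lh).

Lemma groupoid_ext (g h : Gamma) :
  rng g = rng h -> deg g = deg h -> src g = src h -> g = h.
Proof.
case: g h => [x m y p] [x' m' y' p'] /= xE mE yE.
by subst x' m' y'; congr Arrow; exact: Prop_irrelevance.
Qed.

(** Two arrows with the same ends and provably equal degrees are equal, but the
    type of a function value depends on the arrow; fixing both ends makes the
    two values comparable. *)
Lemma arrow_fun_irr (S : X -> Type) (a : forall g : Gamma, S (src g)) x m m' y
    (p : tail_equiv sigma x m y) (p' : tail_equiv sigma x m' y) :
  m = m' -> a (Arrow sigma_lh p) = a (Arrow sigma_lh p').
Proof. by move=> mE; subst m'; rewrite (Prop_irrelevance p p'). Qed.

Lemma tail_sym x m y : tail_equiv sigma x m y -> tail_equiv sigma y (- m) x.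
Proof. by move=> [k [l [kl <-]]]; exists l, k; rewrite opprB. Qed.

Definition ginv (g : Gamma) : Gamma := Arrow sigma_lh (tail_sym (arrowP g)).

Definition gunit x : Gamma := Arrow sigma_lh (tail_unit sigma x).

Lemma tail_div (g h : Gamma) : rng h = rng g ->
  tail_equiv sigma (src g) (- deg g + deg h) (src h).
Proof.
move=> hg; apply: tail_comp (tail_sym (arrowP g)) _; rewrite -hg.
exact: arrowP.
Qed.

(** The product of the inverse of g with h. It is made total by the value h on
    the pairs without a common range, so that it can be composed freely. All
    products are expressed by it, with [ginv]. *)
Definition ldiv (g h : Gamma) : Gamma :=
  if pselect (rng h = rng g) is left e then Arrow sigma_lh (tail_div e) else h.

Lemma ldivE (g h : Gamma) : rng h = rng g ->
  [/\ rng (ldiv g h) = src g, deg (ldiv g h) = - deg g + deg h &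
      src (ldiv g h) = src h].
Proof. by rewrite /ldiv; case: pselect. Qed.

Lemma ldiv_inv (g h : Gamma) : rng h = rng g -> ldiv (ginv g) (ldiv g h) = h.
Proof.
move=> hg; have [r d s] := ldivE hg.
have [r' d' s'] := ldivE (g := ginv g) r.
apply: groupoid_ext; first by rewrite r'.
  by rewrite d' d /= opprK addNKr.
by rewrite s'.
Qed.

Lemma iter_sigma_continuous k : continuous (iter k sigma).
Proof.
elim: k => [|k IH] x; first exact: cvg_id.
exact: (continuous_comp (IH x) (@sigma_continuous _ _ sigma_lh (iter k sigma x))).
Qed.

Lemma iter_sigma_open k (W : set X) : open W -> open (iter k sigma @` W).
Proof.
move=> oW; elim: k => [|k IH]; first by rewrite image_id.
rewrite (_ : _ @` W = sigma @` (iter k sigma @` W)).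
  exact: local_homeomorphism_open.
by rewrite -image_comp.
Qed.

Lemma basic_bisection_open i :
  basic_domain sigma i -> open (bisection i).
Proof. by move=> di; exists [set i]; [move=> _ ->|rewrite bigcup_set1]. Qed.

Lemma open_bisection (O : set Gamma) g : open O -> O g ->
  exists i, [/\ basic_domain sigma i, bisection i g &
                bisection i `<=` O].
Proof.
move=> [D DD <-] [i Di ig]; exists i; split; [exact: DD|by []|].
by move=> h ih; exists i.
Qed.

Lemma bisection_at g : exists k l,
  [/\ iter k sigma (rng g) = iter l sigma (src g), deg g = k%:Z - l%:Z &
    exists U V, basic_domain sigma (U, V, k, l) /\
      bisection (U, V, k, l) g].
Proof.
have : [set: Gamma] g by [].
rewrite -(basic_cover sigma_lh) => -[[[[U V] k] l] di ig].
by have [_ _ dg eg] := ig; exists k, l; split => //; exists U, V.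
Qed.

Lemma src_continuous : continuous (@src X sigma sigma_lh).
Proof.
move=> g; apply/continuous_forP => O oO Og.
have [k [l [_ _ [U [V [[oU oV iU iV] [gU gV dg eg]]]]]]] := bisection_at g.
have di : basic_domain sigma (U, V `&` O, k, l).
  split=> //; first exact: openI.
  by move=> x y /[!inE] -[Vx _] [Vy _]; apply: iV; rewrite inE.
have : nbhs g (bisection (U, V `&` O, k, l)).
  by apply: open_nbhs_nbhs; split; first exact: basic_bisection_open.
by apply: filterS => h [_ []].
Qed.

(** The criterion by which all structure maps are shown to be continuous. A
    basic open set at c y may involve exponents k' < k and l' < l, and then the
    equation sigma^k' = sigma^l' has to be recovered from the one for k and l:
    both sides are equal at y, and a power of sigma identifies them near y, so
    they agree near y because that power is locally injective. *)
Lemma continuous_arrow (Y : topologicalType) (c : Y -> Gamma) y k l :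
  {for y, continuous (fun z => rng (c z))} ->
  {for y, continuous (fun z => src (c z))} ->
  (\forall z \near y, deg (c z) = k%:Z - l%:Z /\
     iter k sigma (rng (c z)) = iter l sigma (src (c z))) ->
  {for y, continuous c}.
Proof.
move=> cr cs ckl; apply/continuous_forP => O oO Oc.
have [[[[U V] k'] l'] [[oU oV _ _] [cU cV dc ec] sO]] := open_bisection oO Oc.
have nU : \forall z \near y, U (rng (c z)) by move/continuous_forP: cr; exact.
have nV : \forall z \near y, V (src (c z)) by move/continuous_forP: cs; exact.
suff kl' : \forall z \near y,
    iter k' sigma (rng (c z)) = iter l' sigma (src (c z)).
  have [dy _] := nbhs_singleton ckl.
  have nd : \forall z \near y, deg (c z) = k'%:Z - l'%:Z.
    by apply: filterS ckl => z [-> _]; rewrite -dy.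
  by apply: filterS3 (filterI nU nV) nd kl' => z [Uz Vz] dz ez; apply: sO.
have klE : (k + l' = k' + l)%N.
  have [dy _] := nbhs_singleton ckl.
  have : (k%:Z + l'%:Z = k'%:Z + l%:Z)%R.
    by apply/eqP; rewrite -subr_eq addrAC -dy dc subrK.
  by case.
have [kk'|/ltnW k'k] := leqP k k'.
  apply: filterS ckl => z [_ e].
  have -> : k' = ((k' - k) + k)%N by rewrite subnK.
  have -> : l' = ((k' - k) + l)%N.
    by apply/eqP; rewrite -(eqn_add2l k) klE addnA subnKC.
  by rewrite !iterD e.
have [W oW iW] := iter_locally_injective sigma_lh (k - k') (iter k' sigma (rng (c y))).
have nW : nbhs (iter k' sigma (rng (c y))) W by exact: open_nbhs_nbhs.
have nWr : \forall z \near y, W (iter k' sigma (rng (c z))).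
  exact: (continuous_comp cr (@iter_sigma_continuous k' _) nW).
have nWs : \forall z \near y, W (iter l' sigma (src (c z))).
  move: nW; rewrite ec => nW.
  exact: (continuous_comp cs (@iter_sigma_continuous l' _) nW).
apply: filterS3 ckl nWr nWs => z [_ e] Wr Ws; apply: iW; rewrite ?inE//.
rewrite -!iterD subnK// e; congr (iter _ sigma _).
by apply/eqP; rewrite -(eqn_add2l k') addnA subnKC// klE.
Qed.

Lemma bisection_near (Y : topologicalType) (c : Y -> Gamma) y :
  {for y, continuous c} -> exists k l, \forall z \near y,
     deg (c z) = k%:Z - l%:Z /\
     iter k sigma (rng (c z)) = iter l sigma (src (c z)).
Proof.
move=> cc; have [k [l [_ _ [U [V [di ig]]]]]] := bisection_at (c y).
exists k, l; move/continuous_forP: cc => /(_ _ (basic_bisection_open di) ig).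
by apply: filterS => z [].
Qed.

Lemma continuous_rng_for (Y : topologicalType) (c : Y -> Gamma) y :
  {for y, continuous c} -> {for y, continuous (fun z => rng (c z))}.
Proof. by move=> cc; exact: (continuous_comp cc (@rng_continuous _ _ sigma_lh _)). Qed.

Lemma continuous_src_for (Y : topologicalType) (c : Y -> Gamma) y :
  {for y, continuous c} -> {for y, continuous (fun z => src (c z))}.
Proof. by move=> cc; exact: (continuous_comp cc (@src_continuous _)). Qed.

Lemma ginv_continuous_for (Y : topologicalType) (c : Y -> Gamma) y :
  {for y, continuous c} -> {for y, continuous (fun z => ginv (c z))}.
Proof.
move=> cc; have [k [l ckl]] := bisection_near cc.
apply: (@continuous_arrow _ _ _ l k).
- exact: continuous_src_for.
- exact: continuous_rng_for.
- by apply: filterS ckl => z [dz ez]; rewrite /= dz opprB.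
Qed.

(** If sigma^k x = sigma^l (src b) and sigma^k' x = sigma^l' (src c), then
    sigma^(k'+l) (src b) = sigma^(k+k') x = sigma^(k+l') (src c). *)
Lemma ldiv_continuous_for (Y : topologicalType) (b c : Y -> Gamma) y :
  {for y, continuous b} -> {for y, continuous c} ->
  (\forall z \near y, rng (c z) = rng (b z)) ->
  {for y, continuous (fun z => ldiv (b z) (c z))}.
Proof.
move=> cb cc bc.
have [k [l bkl]] := bisection_near cb; have [k' [l' ckl]] := bisection_near cc.
apply: (@continuous_arrow _ _ _ (k' + l) (k + l')).
- apply: continuous_for_near_eq (continuous_src_for cb).
  by apply: filterS bc => z /ldivE[].
- apply: continuous_for_near_eq (continuous_src_for cc).
  by apply: filterS bc => z /ldivE[].
- apply: filterS3 bc bkl ckl => z bcz [db eb] [dc ec].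
  have [-> -> ->] := ldivE bcz; rewrite db dc; split.
    by rewrite !PoszD opprB opprD addrACA [l%:Z + _]addrC.
  by rewrite iterD -eb -bcz -iterD addnC iterD ec -iterD.
Qed.

Lemma gunit_continuous : continuous gunit.
Proof.
move=> x; apply: (@continuous_arrow _ _ _ 0 0); [exact: cvg_id|exact: cvg_id|].
exact: nearW.
Qed.

Lemma rng_local_homeo : local_homeomorphism (@rng X sigma sigma_lh).
Proof.
move=> g; have [k [l [_ _ [U [V [di ig]]]]]] := bisection_at g.
exists (bisection (U, V, k, l)).
  by split=> //; exact: basic_bisection_open.
split=> [h _|h h' /set_mem[Uh Vh dh eh] /set_mem[Uh' Vh' dh' eh'] hh'|W _ oW].
- exact: rng_continuous.
- apply: groupoid_ext => //; first by rewrite dh.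
  by have [_ _ _ iV] := di; apply: iV; rewrite ?inE// -eh -eh' hh'.
- rewrite openE => _ [h Wh <-].
  have [[[[U' V'] k'] l'] [[oU oV _ _] [hU hV dh eh] sW]] := open_bisection oW Wh.
  have nh : nbhs (rng h)
      (U' `&` (iter k' sigma @^-1` (iter l' sigma @` V'))).
    apply: open_nbhs_nbhs; split; last by split=> //; exists (src h).
    apply: openI => //.
    have /continuousP := @iter_sigma_continuous k'; apply.
    exact: iter_sigma_open.
  apply: filterS nh => x [Ux [v Vv vE]].
  have p : tail_equiv sigma x (k'%:Z - l'%:Z) v by exists k', l'.
  by exists (Arrow sigma_lh p) => //; apply: sW; split.
Qed.

Lemma hausdorff_neq_near (Y : topologicalType) (u v : Y -> X) y :
  hausdorff_space X -> {for y, continuous u} -> {for y, continuous v} ->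
  u y <> v y -> \forall z \near y, u z <> v z.
Proof.
rewrite open_hausdorff => haus cu cv /eqP /haus[[P Q] /= [uP vQ] [oP oQ /eqP PQ]].
have nu : \forall z \near y, P (u z).
  by move/continuous_forP: cu; apply=> //; exact: set_mem.
have nv : \forall z \near y, Q (v z).
  by move/continuous_forP: cv; apply=> //; exact: set_mem.
apply: filterS2 nu nv => z Pu Qv uv.
have : (P `&` Q) (u z) by split=> //; rewrite uv.
by rewrite PQ.
Qed.

(** The groupoid is Hausdorff: the ends lie in a Hausdorff space, and the degree
    is locally constant. *)
Lemma groupoid_neq_near (Y : topologicalType) (c d : Y -> Gamma) y :
  hausdorff_space X -> {for y, continuous c} -> {for y, continuous d} ->
  c y <> d y -> \forall z \near y, c z <> d z.
Proof.
move=> haus cc cd cdy.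
have [r|r] := pselect (rng (c y) = rng (d y)); last first.
  apply: filterS (hausdorff_neq_near haus (continuous_rng_for cc)
    (continuous_rng_for cd) r) => z + e.
  by rewrite e => /(_ erefl).
have [s|s] := pselect (src (c y) = src (d y)); last first.
  apply: filterS (hausdorff_neq_near haus (continuous_src_for cc)
    (continuous_src_for cd) s) => z + e.
  by rewrite e => /(_ erefl).
have [k [l ckl]] := bisection_near cc; have [k' [l' dkl]] := bisection_near cd.
have [dc _] := nbhs_singleton ckl; have [dd _] := nbhs_singleton dkl.
apply: filterS2 ckl dkl => z [dcz _] [ddz _] e; apply: cdy.
by apply: groupoid_ext => //; rewrite dc dd -dcz -ddz e.
Qed.

Lemma act_continuous_for (Q : gamma_sheaf sigma_lh) (Y : topologicalType) (c : Y -> Gamma)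
    (a : forall y, Q (src (c y))) y :
  {for y, continuous c} -> {for y, continuous (fun z => etale_pt (a z))} ->
  {for y, continuous (fun z => etale_pt (act Q (c z) (a z)))}.
Proof.
move=> cc ca.
pose w z : initial_topology (@action_domain_pair _ _ sigma_lh Q) :=
  existT (fun g : Gamma => Q (src g)) (c z) (a z).
have cw : {for y, continuous w}.
  have cca : {for y, continuous (fun z => (c z, etale_pt (a z)))}.
    exact: (cvg_pair cc ca).
  by apply/continuous_forP => _ [O oO <-]; move/continuous_forP: cca; exact.
exact: (continuous_comp cw (@act_cont _ _ _ Q (w y))).
Qed.

End GroupoidStructure.

(** * The free equivariant sheaf on a sheaf *)

Section FreeStalk.
Variables (X : topologicalType) (sigma : X -> X).
Variables (sigma_lh : local_homeomorphism sigma) (B : sheaf X).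
Local Notation Gamma := (groupoid sigma_lh).

(** Finitely supported functions on the arrows over x. The range condition is on
    the support and not on the argument, so that no coefficient is ever
    transported along an equality of points. *)
Record free_stalk (x : X) := FreeStalk {
  coeff :> forall g : Gamma, B (src g);
  coeff_fin : finite_set [set g | coeff g <> 0];
  coeff_rng : forall g, coeff g <> 0 -> rng g = x }.

Lemma free_stalk_ext x (a b : free_stalk x) : (forall g, a g = b g) -> a = b.
Proof.
case: a b => [a fa ra] [b fb rb] /= ab.
have eab : a = b by exact: functional_extensionality_dep.
by case: _ / eab in fb rb *; congr FreeStalk; exact: Prop_irrelevance.
Qed.

HB.instance Definition _ x := gen_eqMixin (free_stalk x).
HB.instance Definition _ x := gen_choiceMixin (free_stalk x).

Lemma coeff0_fin : finite_set [set g : Gamma | (0 : B (src g)) <> 0].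
Proof. by rewrite (_ : mkset _ = set0)// -subset0 => g. Qed.

Definition free_stalk0 x : free_stalk x :=
  @FreeStalk x (fun=> 0) coeff0_fin (fun g g0 => False_ind _ (g0 erefl)).

Lemma coeff_opp_fin x (a : free_stalk x) : finite_set [set g | - a g <> 0].
Proof.
apply: sub_finite_set (coeff_fin a) => g /= ag a0; apply: ag.
by rewrite a0 oppr0.
Qed.

Lemma coeff_opp_rng x (a : free_stalk x) g : - a g <> 0 -> rng g = x.
Proof. by move=> ag; apply: (@coeff_rng _ a) => a0; apply: ag; rewrite a0 oppr0. Qed.

Definition free_stalk_opp x (a : free_stalk x) : free_stalk x :=
  FreeStalk (coeff_opp_fin a) (@coeff_opp_rng x a).

Lemma coeff_add_supp x (a b : free_stalk x) g :
  a g + b g <> 0 -> a g <> 0 \/ b g <> 0.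
Proof.
move=> ab; have [a0|] := pselect (a g = 0); last by left.
by right => b0; apply: ab; rewrite a0 b0 addr0.
Qed.

Lemma coeff_add_fin x (a b : free_stalk x) : finite_set [set g | a g + b g <> 0].
Proof.
apply: (@sub_finite_set _ _ ([set g | a g <> 0] `|` [set g | b g <> 0])).
  by move=> g; exact: coeff_add_supp.
by rewrite finite_setU; split; exact: coeff_fin.
Qed.

Lemma coeff_add_rng x (a b : free_stalk x) g : a g + b g <> 0 -> rng g = x.
Proof. by case/coeff_add_supp; exact: coeff_rng. Qed.

Definition free_stalk_add x (a b : free_stalk x) : free_stalk x :=
  FreeStalk (coeff_add_fin a b) (@coeff_add_rng x a b).

Lemma free_stalk_addA x : associative (@free_stalk_add x).
Proof. by move=> a b c; apply: free_stalk_ext => g /=; rewrite addrA. Qed.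
Lemma free_stalk_addC x : commutative (@free_stalk_add x).
Proof. by move=> a b; apply: free_stalk_ext => g /=; rewrite addrC. Qed.
Lemma free_stalk_add0 x : left_id (free_stalk0 x) (@free_stalk_add x).
Proof. by move=> a; apply: free_stalk_ext => g /=; rewrite add0r. Qed.
Lemma free_stalk_addN x :
  left_inverse (free_stalk0 x) (@free_stalk_opp x) (@free_stalk_add x).
Proof. by move=> a; apply: free_stalk_ext => g /=; rewrite addNr. Qed.
HB.instance Definition _ x := GRing.isZmodule.Build (free_stalk x)
  (@free_stalk_addA x) (@free_stalk_addC x) (@free_stalk_add0 x)
  (@free_stalk_addN x).

Lemma coeff_eq0 x (a : free_stalk x) g : rng g <> x -> a g = 0.
Proof.
by move=> gx; have [//|/(@coeff_rng _ a)] := pselect (a g = 0).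
Qed.

Definition supported_at x (a : free_stalk x) (g : Gamma) : Prop :=
  rng g = x /\ forall h, h <> g -> a h = 0.

(** Additive statements on the direct sum need only be checked on its summands. *)
Lemma free_stalk_ind x (P : free_stalk x -> Prop) :
  P 0 -> (forall a b, P a -> P b -> P (a + b)) ->
  (forall a g, supported_at a g -> P a) -> forall a, P a.
Proof.
move=> P0 PD P1 a; have /finite_seqP[s sE] := coeff_fin a.
have {sE} : forall g, a g <> 0 -> g \in s.
  move=> g ag; have : [set` s] g by rewrite -sE.
  exact.
elim: s a => [|g s IH] a sa.
  suff -> : a = 0 by [].
  by apply: free_stalk_ext => g; have [//|/sa] := pselect (a g = 0).
pose b h := if pselect (h = g) is left _ then a h else 0.
have bP h : b h <> 0 -> h = g /\ a h <> 0 by rewrite /b; case: pselect.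
have b_fin : finite_set [set h | b h <> 0].
  by apply: sub_finite_set (coeff_fin a) => h /= /bP[].
have b_rng h : b h <> 0 -> rng h = x by move=> /bP[_]; exact: coeff_rng.
pose b' := FreeStalk b_fin b_rng.
rewrite -(subrK b' a); apply: PD.
  apply: IH => h /= ah.
  have hg : h <> g.
    by move=> hg; apply: ah; rewrite /b; case: pselect => // _; rewrite subrr.
  have : a h <> 0.
    by move=> a0; apply: ah; rewrite /b; case: pselect => // _; rewrite a0 subrr.
  by move/sa; rewrite inE => /orP[/eqP|].
have [ag|/(@coeff_rng _ a) gx] := pselect (a g = 0).
  suff -> : b' = 0 by [].
  by apply: free_stalk_ext => h /=; rewrite /b; case: pselect => // ->.
by apply: (P1 _ g); split=> // h hg /=; rewrite /b; case: pselect.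
Qed.

End FreeStalk.

Section FreeSheaf.
Variables (X : topologicalType) (sigma : X -> X).
Variables (sigma_lh : local_homeomorphism sigma) (X_haus : hausdorff_space X).
Variable B : sheaf X.
Local Notation Gamma := (groupoid sigma_lh).
Local Notation S := (@free_stalk X sigma sigma_lh B).
Implicit Types (x y z : X) (s t : forall y, S y) (g h : Gamma).

(** A family of elements of the stalks, seen as a function on the groupoid with
    values in B along src. *)
Definition coeff_map s (g : Gamma) : etale B := etale_pt (s (rng g) g).

(** The second condition says that the support of s is proper over X: it stays
    close to the fibre of rng over x. As each stalk consists of finitely
    supported functions, this makes s near x a finite sum of local sections of B
    carried by local sections of rng. *)
Definition free_good_at (s : forall y, S y) (x : X) : Prop :=
  (forall g, rng g = x -> {for g, continuous (coeff_map s)}) /\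
  (forall O : set Gamma, open O -> (forall g, rng g = x -> O g) ->
     \forall y \near x, forall g, s y g <> 0 -> O g).

Definition free_good (x : X) s : Prop := \forall y \near x, free_good_at s y.

Lemma coeff_supp s y g : s y g <> 0 -> s (rng g) g <> 0.
Proof. by move=> sg; have := coeff_rng sg => gy; subst y. Qed.

Lemma free_good_eq0 x s : free_good x s -> s x = 0 -> \forall y \near x, s y = 0.
Proof.
move=> /nbhs_singleton[sc ss] sx.
(* Each coefficient vanishes near the fibre over x, by uniqueness of germs in B;
   properness makes this uniform in the arrow. *)
pose O := [set g : Gamma | s (rng g) g = 0]°.
have : \forall y \near x, forall g, s y g <> 0 -> O g.
  apply: ss; first exact: open_interior.
  move=> g gx; have sg : s (rng g) g = 0 by rewrite gx sx.
  exact: (etale_eq_near (sc g gx)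
    (etale_zero_continuous_for (@src_continuous _ _ _ _)) sg).
apply: filterS => y sO; apply: free_stalk_ext => g.
have [//|sg] := pselect (s y g = 0).
by have /interior_subset := sO g sg; have := coeff_supp sg.
Qed.

Lemma free_good_sub x s t :
  free_good x s -> free_good x t -> free_good x (fun y => s y - t y).
Proof.
apply: filterS2 => y [sc ss] [tc ts]; split=> [g gy|O oO Oy].
  exact: (etale_sub_continuous_for (sc g gy) (tc g gy)).
apply: filterS2 (ss O oO Oy) (ts O oO Oy) => z sO tO g /= stg.
have [s0|/sO//] := pselect (s z g = 0).
by apply: tO => t0; apply: stg; rewrite s0 t0 subrr.
Qed.

(** A section c of rng and a section b of B give the section of the free sheaf
    whose value at y is b (src (c y)) in the summand of c y. *)
Section Elementary.
Variables (c : X -> Gamma) (b : forall y, B y).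

Definition elem_coeff y g : B (src g) :=
  if pselect (g = c y /\ rng g = y) is left _ then b (src g) else 0.

Lemma elem_coeffP y g : elem_coeff y g <> 0 -> g = c y /\ rng g = y.
Proof. by rewrite /elem_coeff; case: pselect. Qed.

Lemma elem_fin y : finite_set [set g | elem_coeff y g <> 0].
Proof. by apply: (@sub_finite_set _ _ [set c y]) => // g /elem_coeffP[]. Qed.

Definition elem y : S y :=
  FreeStalk (elem_fin y) (fun g ag => proj2 (elem_coeffP ag)).

(** Away from the image of c the coefficients have to vanish locally, and it is
    here that the groupoid must be Hausdorff. *)
Lemma elem_good x :
  (\forall y \near x, rng (c y) = y /\ {for y, continuous c}) ->
  (\forall y \near src (c x), {for y, continuous (fun z => etale_pt (b z))}) ->
  free_good x elem.
Proof.
move=> nc nb; have [_ ccx] := nbhs_singleton nc.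
have nb' : \forall y \near x,
    {for src (c y), continuous (fun z => etale_pt (b z))}.
  exact: (continuous_src_for ccx nb).
apply: filterS3 (near_join nc) nc nb' => y ncy [cy ccy] cb.
split=> [g gy|O oO Oy]; last first.
  have nO : \forall z \near y, O (c z).
    by move/continuous_forP: ccy; apply=> //; exact: Oy.
  by apply: filterS nO => z Oz g /elem_coeffP[->].
have crg : {for g, continuous (fun h : Gamma => rng h)}.
  exact: rng_continuous.
have ccg : {for g, continuous (fun h => c (rng h))}.
  by apply: continuous_comp crg _; rewrite gy.
have ncg : \forall h \near g, rng (c (rng h)) = rng h.
  have : \forall z \near rng g, rng (c z) = z.
    by rewrite gy; apply: filterS ncy => z [].
  exact: crg.
have [gc|gc] := pselect (g = c (rng g)).
  have h0 : \forall h \near g, h = c (rng h).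
    apply: (local_homeomorphism_lift_unique (@rng_local_homeo _ _ sigma_lh)
      (@cvg_id _ (nbhs g)) ccg gc).
    by apply: filterS ncg => h ->.
  have cbg : {for g, continuous (fun h => etale_pt (b (src h)))}.
    apply: (@continuous_comp _ _ _ (@src _ _ sigma_lh) (fun z => etale_pt (b z))).
      exact: src_continuous.
    by rewrite gc gy.
  apply: continuous_for_near_eq cbg; apply: filterS h0 => h hc.
  rewrite /coeff_map /= /elem_coeff; case: pselect => // -[]; split=> //.
have nh : \forall h \near g, h <> c (rng h).
  exact: (groupoid_neq_near X_haus (@cvg_id _ (nbhs g)) ccg gc).
apply: continuous_for_near_eq
  (etale_zero_continuous_for (@src_continuous _ _ _ _)).
apply: filterS nh => h hc.
by rewrite /coeff_map /= /elem_coeff; case: pselect => // -[].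
Qed.

End Elementary.

Lemma elem_at x (a : S x) g : supported_at a g ->
  exists c b, [/\ elem c b x = a, c x = g,
    \forall y \near x, rng (c y) = y /\ {for y, continuous c} &
    \forall y \near src g, {for y, continuous (fun z => etale_pt (b z : B z))}].
Proof.
move=> [gx ag].
have [c [cg nc]] := local_homeomorphism_section g (@rng_local_homeo _ _ sigma_lh).
have [b bg nb] := local_section_ex (a g).
subst x; exists c, b; split=> //.
apply: free_stalk_ext => h /=; rewrite /elem_coeff.
case: pselect => [[-> _]|hg]; first by rewrite cg.
by apply/esym/ag => hE; apply: hg; rewrite hE cg.
Qed.

Lemma free_good0 x : free_good x (fun=> 0).
Proof.
apply: nearW => y; split=> [g _|O oO _].
  exact: (etale_zero_continuous_for (@src_continuous _ _ _ _)).
by apply: nearW => z g /=.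
Qed.

Lemma free_good_add x s t :
  free_good x s -> free_good x t -> free_good x (fun y => s y + t y).
Proof.
move=> gs gt; have := free_good_sub gs (free_good_sub (free_good0 x) gt).
congr (free_good x _); apply: functional_extensionality_dep => y.
by rewrite sub0r opprK.
Qed.

Lemma free_good_ex x (a : S x) : exists2 s, free_good x s & s x = a.
Proof.
elim/free_stalk_ind: a => [|_ _ [s gs <-] [t gt <-]|a g /elem_at].
- by exists (fun=> 0) => //; exact: free_good0.
- by exists (fun y => s y + t y) => //; exact: free_good_add.
- move=> [c [b [<- cg nc nb]]]; exists (elem c b) => //.
  by apply: elem_good => //; rewrite cg.
Qed.

Definition free_germs : germs S :=
  @Germs X S free_good (fun x s => @near_join X x _) free_good_ex free_good_eq0
    free_good_sub.

Definition free_sheaf : sheaf X := germ_sheaf free_germs.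

End FreeSheaf.

(** * The action on the free sheaf *)

Section FreeAction.
Variables (X : topologicalType) (sigma : X -> X).
Variables (sigma_lh : local_homeomorphism sigma) (X_haus : hausdorff_space X).
Variable B : sheaf X.
Local Notation Gamma := (groupoid sigma_lh).
Local Notation S := (@free_stalk X sigma sigma_lh B).
Implicit Types (x y z : X) (s t : forall y, S y) (g h k : Gamma).

(** The action on functions, (g a)(h) = a(g^-1 h); the argument is the arrow
    underlying [ldiv g h], spelled out because its source is then src h by
    definition. *)
Definition translate g (a : forall h : Gamma, B (src h)) h : B (src h) :=
  if pselect (rng h = rng g) is left e then a (Arrow sigma_lh (tail_div e)) else 0.

Lemma translateP g a h : translate g a h <> 0 ->
  rng h = rng g /\ a (ldiv g h) <> 0.
Proof. by rewrite /translate /ldiv; case: pselect. Qed.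

Lemma etale_translate g (a : forall h : Gamma, B (src h)) h : rng h = rng g ->
  etale_pt (translate g a h) = etale_pt (a (ldiv g h)) :> etale B.
Proof. by rewrite /translate /ldiv; case: pselect. Qed.

Lemma translate_fin g (a : S (src g)) : finite_set [set h | translate g a h <> 0].
Proof.
apply: sub_finite_set (finite_image (ldiv (ginv g)) (coeff_fin a)).
by move=> h /translateP[hg ah]; exists (ldiv g h) => //; exact: ldiv_inv.
Qed.

Definition free_act_fun g (a : S (src g)) : S (rng g) :=
  FreeStalk (translate_fin a) (fun h ah => proj1 (translateP ah)).

Lemma free_act_zmod_morphism g : zmod_morphism (@free_act_fun g).
Proof.
move=> a b; apply: free_stalk_ext => h /=; rewrite /translate.
by case: pselect => // _; rewrite subr0.
Qed.
HB.instance Definition _ g := GRing.isZmodMorphism.Build (S (src g)) (S (rng g))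
  (@free_act_fun g) (@free_act_zmod_morphism g).

Lemma free_act_unit x (a : S x) :
  free_act_fun (g := Arrow sigma_lh (tail_unit sigma x)) a = a.
Proof.
apply: free_stalk_ext => h /=; rewrite /translate; case: pselect => [/=|hx]; last first.
  by rewrite coeff_eq0.
case: h => [y m z p] /= e; subst y; apply: (@arrow_fun_irr _ _ _ (fun y => B y) a x (- 0 + m) m z).
by rewrite oppr0 add0r.
Qed.

Lemma free_act_comp x m y n z (p : tail_equiv sigma x m y)
    (q : tail_equiv sigma y n z) (a : S z) :
  free_act_fun (g := Arrow sigma_lh (tail_comp p q)) a =
  free_act_fun (g := Arrow sigma_lh p) (free_act_fun (g := Arrow sigma_lh q) a).
Proof.
apply: free_stalk_ext => h /=; rewrite /translate; case: pselect => //= e.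
case: pselect => // e'; apply: (@arrow_fun_irr _ _ _ (fun y => B y) a).
by rewrite opprD [- m - n]addrC -addrA.
Qed.

Lemma free_act_bij g : bijective (@free_act_fun g).
Proof.
case: g => [x m y p]; pose q := tail_sym p.
have irr w (r : tail_equiv sigma w 0 w) (a : S w) :
    free_act_fun (g := Arrow sigma_lh r) a = a.
  by rewrite (Prop_irrelevance r (tail_unit sigma w)) free_act_unit.
have irr' w d (r : tail_equiv sigma w d w) (a : S w) : d = 0 ->
    free_act_fun (g := Arrow sigma_lh r) a = a.
  by move=> d0; subst d; exact: irr.
exists (@free_act_fun (Arrow sigma_lh q)) => a.
  by rewrite -(free_act_comp q p a) irr' ?addNr.
by rewrite -(free_act_comp p q a) irr' ?addrN.
Qed.

(** Translating a section s by a section c of rng: the value at y is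
    (c y) (s (src (c y))). *)
Section ActionSection.
Variables (c : X -> Gamma) (s : forall y, S y).

Definition act_section_coeff y h : B (src h) :=
  if pselect (rng (c y) = y) is left _ then translate (c y) (s (src (c y))) h else 0.

Lemma act_section_coeffP y h : act_section_coeff y h <> 0 ->
  [/\ rng (c y) = y, rng h = y & s (src (c y)) (ldiv (c y) h) <> 0].
Proof.
rewrite /act_section_coeff; case: pselect => // cy /translateP[hc sh]; split=> //.
by rewrite hc.
Qed.

Lemma act_section_fin y : finite_set [set h | act_section_coeff y h <> 0].
Proof.
apply: sub_finite_set
  (finite_image (ldiv (ginv (c y))) (coeff_fin (s (src (c y))))).
move=> h /act_section_coeffP[cy hy sh]; exists (ldiv (c y) h) => //.
by apply: ldiv_inv; rewrite hy.
Qed.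

Lemma act_section_rng y h : act_section_coeff y h <> 0 -> rng h = y.
Proof. by case/act_section_coeffP. Qed.

Definition act_section y : S y :=
  FreeStalk (act_section_fin y) (@act_section_rng y).

(** The coefficient at k of the translate is that of s at (c (rng k))^-1 k, and
    division is continuous. For properness, let O be a neighbourhood of the
    fibre over y; the arrows k over src (c y) whose translate lies in O form a
    neighbourhood of the fibre over src (c y), and s has its support there. *)
Lemma act_section_good x :
  (\forall y \near x, rng (c y) = y /\ {for y, continuous c}) ->
  free_good (src (c x)) s -> free_good x act_section.
Proof.
move=> nc gs; have [_ ccx] := nbhs_singleton nc.
have ngs : \forall y \near x, free_good_at s (src (c y)).
  exact: (continuous_src_for ccx gs).
apply: filterS3 (near_join nc) nc ngs => y ncy [cy ccy] [sc ss].
split=> [h hy|O oO Oy].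
  have crh : {for h, continuous (fun k : Gamma => rng k)} by exact: rng_continuous.
  have cch : {for h, continuous (fun k => c (rng k))}.
    by apply: continuous_comp crh _; rewrite hy.
  have nch : \forall k \near h, rng (c (rng k)) = rng k.
    have : \forall z \near rng h, rng (c z) = z.
      by rewrite hy; apply: filterS ncy => z [].
    exact: crh.
  have hc : rng h = rng (c (rng h)) by rewrite hy cy.
  have cd : {for h, continuous (fun k => ldiv (c (rng k)) k)}.
    apply: ldiv_continuous_for => //.
    by apply: filterS nch => k ->.
  have csd : {for h, continuous (fun k => coeff_map s (ldiv (c (rng k)) k))}.
    apply: (@continuous_comp _ _ _ (fun k => ldiv (c (rng k)) k) (coeff_map s)) => //.
    by apply: sc; have [-> _ _] := ldivE hc; rewrite hy.
  apply: continuous_for_near_eq csd; apply: filterS nch => k kc.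
  rewrite /coeff_map /= /act_section_coeff; case: pselect => // _.
  rewrite etale_translate//.
  by have [-> _ _] := ldivE (esym kc).
(* Translating k requires c z with src (c z) = rng k; the germ d of a section of
   rng at the inverse of c y provides it, as d (src (c z)) = (c z)^-1. *)
have [d [dc nd]] :=
  local_homeomorphism_section (ginv (c y)) (@rng_local_homeo _ _ sigma_lh).
have csy : {for y, continuous (fun z => src (c z))} by exact: continuous_src_for.
have [_ cdc] := nbhs_singleton nd.
have ndc : \forall z \near y, d (src (c z)) = ginv (c z).
  apply: (local_homeomorphism_lift_unique (@rng_local_homeo _ _ sigma_lh)) => //.
  - exact: (@continuous_comp _ _ _ (fun z => src (c z)) d _ csy).
  - exact: ginv_continuous_for.
  - have : \forall w \near src (c y), rng (d w) = w.
      by apply: filterS nd => w [].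
    exact: csy.
pose M k := ldiv (d (rng k)) k.
have : \forall w \near src (c y), forall k, s w k <> 0 -> [set k | O (M k)]° k.
  apply: ss; first exact: open_interior.
  move=> k kc.
  have crk : {for k, continuous (fun k : Gamma => rng k)} by exact: rng_continuous.
  have cM : {for k, continuous M}.
    have cdk : {for k, continuous (fun k => d (rng k))}.
      apply: (@continuous_comp _ _ _ (@rng _ _ sigma_lh) d _ crk).
      by rewrite kc.
    apply: ldiv_continuous_for => //.
    have : \forall w \near rng k, w = rng (d w).
      by rewrite kc; apply: filterS nd => w [].
    exact: crk.
  have OM : O (M k).
    apply: Oy; have kd : rng k = rng (d (rng k)) by rewrite kc dc.
    by have [-> _ _] := ldivE kd; rewrite kc dc.
  by move/continuous_forP: cM; exact.
move=> nM; have {nM} : \forall z \near y,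
    forall k, s (src (c z)) k <> 0 -> [set k | O (M k)]° k := csy _ nM.
apply: filterS2 ndc => z dz nM h /act_section_coeffP[cz hz sh].
have := interior_subset (nM _ sh); rewrite /= /M.
have hc : rng h = rng (c z) by rewrite hz.
by have [-> _ _] := ldivE hc; rewrite dz ldiv_inv.
Qed.

End ActionSection.

Local Notation F := (free_sheaf sigma_lh X_haus B).

(** Near (g, a), the arrow is the value of a section c of rng through g, and the
    element that of a section s through a; their action is then the translate of
    s by c, a section depending on the range alone. *)
Lemma free_act_cont : continuous
  (action_total (A := F) (fun g => @free_act_fun g) :
     initial_topology (@action_domain_pair _ _ sigma_lh F) -> _).
Proof.
move=> [g a]; have [s gs sa] := free_good_ex X_haus a.
have [c [cg nc]] := local_homeomorphism_section g (@rng_local_homeo _ _ sigma_lh).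
have gt : free_good (rng g) (act_section c s).
  by apply: act_section_good => //; rewrite cg.
pose D := initial_topology (@action_domain_pair _ _ sigma_lh F).
pose u0 : D := existT _ g a.
have cp : {for u0, continuous
    (fun u : D => @action_domain_pair _ _ sigma_lh F u)}.
  exact: initial_continuous.
have cg1 : {for u0, continuous (fun u : D => projT1 u : Gamma)}.
  apply: (@continuous_comp _ _ _ _ (fun p : Gamma * etale F => p.1) _ cp).
  exact: cvg_fst.
have cg2 : {for u0, continuous
    (fun u : D => @etale_pt _ F _ (projT2 u))}.
  apply: (@continuous_comp _ _ _ _ (fun p : Gamma * etale F => p.2) _ cp).
  exact: cvg_snd.
have nc1 : \forall u \near u0, projT1 u = c (rng (projT1 u)).
  have cr : {for g, continuous (fun k : Gamma => rng k)} by exact: rng_continuous.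
  have : \forall k \near g, k = c (rng k).
    apply: (local_homeomorphism_lift_unique (@rng_local_homeo _ _ sigma_lh)
      (@cvg_id _ (nbhs g)) _ _ _) => //.
      by have [_ ccg] := nbhs_singleton nc; exact: (continuous_comp cr ccg).
    have : \forall z \near rng g, z = rng (c z) by apply: filterS nc => z [].
    exact: cr.
  exact: cg1.
have ns : \forall u \near u0, projT2 u = s (src (projT1 u)).
  have nim : nbhs (@etale_pt _ F _ a)
      (germ_image (G := free_germs sigma_lh X_haus B) setT s).
    apply: open_nbhs_nbhs; split; first by apply: germ_image_open; exact: openT.
    by split.
  have nE : \forall e \near @etale_pt _ F _ a, projT2 e = s (projT1 e).
    by apply: filterS nim => e [].
  exact: (cg2 _ nE).
have ct : {for u0, continuous (fun u : D =>
    @etale_pt _ F _ (act_section c s (rng (projT1 u))))}.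
  apply: (@continuous_comp _ _ _ (fun u : D => rng (projT1 u))
    (fun y => @etale_pt _ F _ (act_section c s y))).
    exact: (continuous_rng_for cg1).
  exact: (@good_continuous _ _ (free_germs sigma_lh X_haus B)).
apply: continuous_for_near_eq ct; apply: filterS2 nc1 ns => -[h b] /= hc hb.
rewrite /action_total /= hb; congr (etale_pt _); apply: free_stalk_ext => k /=.
rewrite /act_section_coeff -hc; case: pselect => //.
Qed.

Definition free_gamma_sheaf : gamma_sheaf sigma_lh :=
  @GammaSheaf X sigma sigma_lh F (fun g => @free_act_fun g)
    free_act_bij free_act_unit free_act_comp free_act_cont.

End FreeAction.

(** * Forgetting the action preserves injectives *)

Section FreeFunctor.
Variables (X : topologicalType) (sigma : X -> X).
Variables (sigma_lh : local_homeomorphism sigma) (X_haus : hausdorff_space X).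
Local Notation Gamma := (groupoid sigma_lh).
Local Notation S := (@free_stalk X sigma sigma_lh).
Local Notation L := (free_gamma_sheaf sigma_lh X_haus).

Section Map.
Variables (A B : sheaf X) (i : sheaf_hom A B).

Lemma free_map_supp x (a : S A x) g : i (src g) (a g) <> 0 -> a g <> 0.
Proof. by move=> iag ag; apply: iag; rewrite ag raddf0. Qed.

Lemma free_map_fin x (a : S A x) : finite_set [set g | i (src g) (a g) <> 0].
Proof. by apply: sub_finite_set (coeff_fin a) => g; exact: free_map_supp. Qed.

Definition free_map_fun x (a : S A x) : S B x :=
  FreeStalk (free_map_fin a) (fun g ag => coeff_rng (free_map_supp ag)).

Lemma free_map_zmod_morphism x : zmod_morphism (@free_map_fun x).
Proof. by move=> a b; apply: free_stalk_ext => g /=; rewrite raddfB. Qed.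
HB.instance Definition _ x := GRing.isZmodMorphism.Build (S A x) (S B x)
  (@free_map_fun x) (@free_map_zmod_morphism x).

Lemma free_map_good x (s : forall y, S A y) :
  free_good x s -> free_good x (fun y => free_map_fun (s y)).
Proof.
apply: filterS => y [sc ss]; split=> [g gy|O oO Oy].
  exact: (sheaf_hom_continuous_for i (sc g gy)).
by apply: filterS (ss O oO Oy) => z sO g /free_map_supp/sO.
Qed.

Lemma free_map_cont :
  continuous (fun e : etale (L A) => @etale_pt _ (L B) _ (free_map_fun (projT2 e))).
Proof.
move=> [x a]; have [s gs <-] := free_good_ex X_haus a.
apply: (@germ_continuous_for _ _ (free_germs sigma_lh X_haus A) _ _ _ _ gs).
exact: (@good_continuous _ _ (free_germs sigma_lh X_haus B) _ _ (free_map_good gs)).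
Qed.

Definition free_map_sheaf : sheaf_hom (L A) (L B) :=
  @SheafHom X (L A) (L B) (fun x => @free_map_fun x) free_map_cont.

Lemma free_map_act g (a : L A (src g)) :
  free_map_sheaf (rng g) (act (L A) g a) = act (L B) g (free_map_sheaf (src g) a).
Proof.
apply: free_stalk_ext => h /=; rewrite /translate; case: pselect => // _.
exact: raddf0.
Qed.

Definition free_map : gamma_hom (L A) (L B) := GammaHom free_map_act.

Lemma free_map_injective : stalkwise_injective i -> stalkwise_injective free_map.
Proof.
move=> i_inj x a b ab; apply: free_stalk_ext => g; apply: (i_inj (src g)).
exact: (congr1 (fun c : S B x => c g) ab).
Qed.

End Map.

Section Unit.
Variable B : sheaf X.

(** The element b in the summand of the unit arrow at x. *)
Definition unit_coeff x (b : B x) g : B (src g) :=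
  if pselect (g = gunit sigma_lh x) is left e
  then eq_rect x (stalk B) b (src g) (esym (congr1 (@src _ _ sigma_lh) e)) else 0.

Lemma unit_coeffP x (b : B x) g : unit_coeff b g <> 0 -> g = gunit sigma_lh x.
Proof. by rewrite /unit_coeff; case: pselect. Qed.

Lemma unit_coeffE x (b : B x) : unit_coeff b (gunit sigma_lh x) = b.
Proof.
rewrite /unit_coeff; case: pselect => // e.
by rewrite (Prop_irrelevance (esym _) (erefl x)).
Qed.

Lemma unit_coeff_fin x (b : B x) : finite_set [set g | unit_coeff b g <> 0].
Proof.
by apply: (@sub_finite_set _ _ [set gunit sigma_lh x]) => // g /unit_coeffP.
Qed.

Lemma unit_coeff_rng x (b : B x) g : unit_coeff b g <> 0 -> rng g = x.
Proof. by move/unit_coeffP => ->. Qed.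

Definition free_unit_fun x (b : B x) : S B x :=
  FreeStalk (unit_coeff_fin b) (@unit_coeff_rng x b).

Lemma free_unit_zmod_morphism x : zmod_morphism (@free_unit_fun x).
Proof.
move=> a b; apply: free_stalk_ext => g.
have [->|gx] := pselect (g = gunit sigma_lh x); first by rewrite /= !unit_coeffE.
by rewrite /= /unit_coeff; case: pselect => // _; rewrite subr0.
Qed.
HB.instance Definition _ x := GRing.isZmodMorphism.Build (B x) (S B x)
  (@free_unit_fun x) (@free_unit_zmod_morphism x).

(** This is what makes the unit continuous: it sends sections to elementary
    sections carried by the units. *)
Lemma free_unit_elem (b : forall y, B y) x :
  free_unit_fun (b x) = elem (gunit sigma_lh) b x.
Proof.
apply: free_stalk_ext => g.
have [->|gx] := pselect (g = gunit sigma_lh x).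
  by rewrite /= unit_coeffE /elem_coeff; case: pselect => // -[].
rewrite /= /unit_coeff /elem_coeff; case: pselect => // _.
by case: pselect => // -[].
Qed.

Lemma free_unit_cont :
  continuous (fun e : etale B => @etale_pt _ (L B) _ (free_unit_fun (projT2 e))).
Proof.
move=> [x b]; have [s sx ns] := local_section_ex b.
have gs : free_good x (elem (gunit sigma_lh) s).
  apply: elem_good => //; apply: nearW => y; split=> //.
  exact: gunit_continuous.
have cp := local_homeomorphism_continuous (@sheaf_local_homeo X B).
have c1 : {for etale_pt b, continuous (fun e : etale B =>
    @etale_pt _ (L B) _ (elem (gunit sigma_lh) s (etale_proj e)))}.
  apply: (@continuous_comp _ _ _ (@etale_proj X B)
    (fun y => @etale_pt _ (L B) _ (elem (gunit sigma_lh) s y))); first exact: cp.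
  exact: (@good_continuous _ _ (free_germs sigma_lh X_haus B)).
have ne : \forall e \near etale_pt b, s (etale_proj e) = projT2 e.
  have c_id : {for etale_pt b, continuous (fun e : etale B => etale_pt (projT2 e))}.
    suff -> : (fun e : etale B => etale_pt (projT2 e)) = id by exact: cvg_id.
    by apply: functional_extensionality_dep => -[].
  apply: (etale_eq_near _ c_id sx).
  apply: (@continuous_comp _ _ _ (@etale_proj X B) (fun y => etale_pt (s y))).
    exact: cp.
  exact: nbhs_singleton ns.
apply: continuous_for_near_eq c1; apply: filterS ne => e /= <-.
by rewrite free_unit_elem.
Qed.

Definition free_unit : sheaf_hom B (L B) :=
  @SheafHom X B (L B) (fun x => @free_unit_fun x) free_unit_cont.

End Unit.

Lemma free_unit_natural (A B : sheaf X) (i : sheaf_hom A B) x (a : A x) :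
  free_unit B x (i x a) = free_map i x (free_unit A x a).
Proof.
apply: free_stalk_ext => g /=.
have [->|gx] := pselect (g = gunit sigma_lh x); first by rewrite !unit_coeffE.
rewrite /unit_coeff; case: pselect => // _.
by rewrite raddf0.
Qed.

Section Descent.
Variables (B : sheaf X) (Q : gamma_sheaf sigma_lh) (f : sheaf_hom B Q).

(** The summands of the stalk at x act into Q (rng g), which is Q x only up to
    the equation rng g = x; arrows with another range contribute zero. *)
Definition act_to x g (b : Q (src g)) : Q x :=
  if pselect (rng g = x) is left e then eq_rect _ (stalk Q) (act Q g b) x e else 0.

Lemma act_toE g b : act_to (rng g) b = act Q g b.
Proof.
rewrite /act_to; case: pselect => // e.
by rewrite (Prop_irrelevance e (erefl (rng g))).
Qed.

Lemma etale_act_to x g b : rng g = x ->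
  etale_pt (act_to x b) = etale_pt (act Q g b) :> etale Q.
Proof. by move=> gx; subst x; rewrite act_toE. Qed.

Lemma act_to_zmod_morphism x g : zmod_morphism (@act_to x g).
Proof.
move=> a b; have [<-|gx] := pselect (rng g = x).
  by rewrite !act_toE raddfB.
by rewrite /act_to; case: pselect => // _; rewrite subr0.
Qed.
HB.instance Definition _ x g := GRing.isZmodMorphism.Build (Q (src g)) (Q x)
  (@act_to x g) (@act_to_zmod_morphism x g).

Definition desc_fun x (a : S B x) : Q x :=
  \sum_(g \in [set: Gamma]) act_to x (f (src g) (a g)).

Lemma desc_fun_seq x (a : S B x) (s : seq Gamma) : uniq s ->
  (forall g, a g <> 0 -> g \in s) ->
  desc_fun a = \sum_(g <- s) act_to x (f (src g) (a g)).
Proof.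
move=> us as'; rewrite /desc_fun (fsbigE s)//.
  by apply: eq_bigl => g; rewrite in_setT.
move=> g _ gs; have [->|/as'] := pselect (a g = 0); last by rewrite (negbTE gs).
by rewrite !raddf0.
Qed.

Lemma desc_fun_zmod_morphism x : zmod_morphism (@desc_fun x).
Proof.
move=> a b; have /finite_seqP[s sE] := coeff_fin a.
have /finite_seqP[t tE] := coeff_fin b.
have as' g : a g <> 0 -> g \in s.
  by move=> ag; have : [set` s] g by rewrite -sE.
have bt g : b g <> 0 -> g \in t.
  by move=> bg; have : [set` t] g by rewrite -tE.
have us : uniq (undup (s ++ t)) by exact: undup_uniq.
rewrite !(desc_fun_seq us).
- rewrite -sumrB; apply: eq_bigr => g _.
  by rewrite -!raddfB.
- by move=> g /bt gt; rewrite mem_undup mem_cat gt orbT.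
- by move=> g /as' gs; rewrite mem_undup mem_cat gs.
- move=> g /= abg; rewrite mem_undup mem_cat.
  have [a0|/as'->//] := pselect (a g = 0).
  rewrite (bt g) ?orbT// => b0; apply: abg; rewrite a0 b0 subrr//.
Qed.
HB.instance Definition _ x := GRing.isZmodMorphism.Build (S B x) (Q x)
  (@desc_fun x) (@desc_fun_zmod_morphism x).

Lemma desc_fun_supported x (a : S B x) g : supported_at a g ->
  desc_fun a = act_to x (f (src g) (a g)).
Proof.
move=> [gx ag]; rewrite (@desc_fun_seq _ _ [:: g]) ?big_seq1//.
by move=> h ah; rewrite inE; apply/eqP; have [//|/ag] := pselect (h = g).
Qed.

(** Continuity can be tested on one section through each element; elementary
    sections, on which [desc_fun] reduces to the action, suffice by additivity. *)
Lemma desc_cont :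
  continuous (fun e : etale (L B) => etale_pt (desc_fun (projT2 e : S B _))).
Proof.
move=> [x a].
suff [s [gs <- cs]] : exists s, [/\ free_good x s, s x = a &
    {for x, continuous (fun y => etale_pt (desc_fun (s y)))}].
  exact: (@germ_continuous_for _ _ (free_germs sigma_lh X_haus B) _ _ _ _ gs).
elim/free_stalk_ind: a => [|_ _ [s [gs <- cs]] [t [gt <- ct]]|a g ag].
- exists (fun=> 0); split=> //; first exact: free_good0.
  have c0 : {for x, continuous (fun y => etale_pt (0 : Q y))}.
    exact: etale_zero_continuous_for.
  by apply: continuous_for_near_eq c0; apply: nearW => y; rewrite raddf0.
- exists (fun y => s y + t y); split=> //; first exact: free_good_add.
  apply: continuous_for_near_eq (etale_add_continuous_for cs ct).
  by apply: nearW => y; rewrite raddfD.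
- have [c [b [ea cg nc nb]]] := elem_at ag.
  rewrite -cg in nb.
  exists (elem c b); split=> //; first exact: elem_good.
  have [_ ccx] := nbhs_singleton nc.
  have cb : {for x, continuous (fun y => etale_pt (f _ (b (src (c y)))))}.
    apply: sheaf_hom_continuous_for.
    apply: (@continuous_comp _ _ _ (fun y => src (c y)) (fun z => etale_pt (b z))).
      exact: continuous_src_for.
    exact: nbhs_singleton nb.
  apply: continuous_for_near_eq (act_continuous_for ccx cb).
  apply: filterS nc => y [cy _].
  rewrite (@desc_fun_supported _ _ (c y)); last first.
    split=> // h hc /=; rewrite /elem_coeff; case: pselect => // -[]//.
  rewrite /= /elem_coeff; case: pselect => [_|[]//].
  by rewrite etale_act_to.
Qed.

Definition desc_sheaf : sheaf_hom (L B) Q :=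
  @SheafHom X (L B) Q (fun x => @desc_fun x) desc_cont.

(** On the summand of h, both sides are the action of the product of g and h. *)
Lemma desc_act g (a : L B (src g)) :
  desc_sheaf (rng g) (act (L B) g a) = act Q g (desc_sheaf (src g) a).
Proof.
rewrite /=; move: a; elim/free_stalk_ind => [|a b IHa IHb|a h [hg ah]].
- by rewrite !raddf0.
- by rewrite !raddfD /= IHa IHb.
rewrite (@desc_fun_supported _ a h)//.
case: g h hg a ah => [x m y p] [y' n z q] /= e; subst y' => a ah.
have ga : supported_at (free_act_fun (g := Arrow sigma_lh p) a)
    (Arrow sigma_lh (tail_comp p q)).
  split=> // -[x' d w r] ne /=; rewrite /translate; case: pselect => //= e.
  subst x'; pose k := Arrow sigma_lh
    (@tail_div _ _ _ (Arrow sigma_lh p) (Arrow sigma_lh r) erefl).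
  apply: (ah k) => rE; apply: ne.
  have [dE wE] : - m + d = n /\ w = z.
    by split; [exact: (congr1 (@deg _ _ _) rE)|exact: (congr1 (@src _ _ _) rE)].
  by apply: groupoid_ext => //=; rewrite -dE addNKr.
rewrite (desc_fun_supported ga).
have -> : free_act_fun (g := Arrow sigma_lh p) a (Arrow sigma_lh (tail_comp p q)) =
    a (Arrow sigma_lh q).
  rewrite /= /translate; case: pselect => // e.
  by apply: (@arrow_fun_irr _ _ _ (fun y => B y) a) => /=; rewrite addKr.
rewrite (act_toE (g := Arrow sigma_lh (tail_comp p q))).
by rewrite (act_toE (g := Arrow sigma_lh q)) act_comp.
Qed.

Definition desc : gamma_hom (L B) Q := GammaHom desc_act.

Lemma desc_unit x (b : B x) : desc x (free_unit B x b) = f x b.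
Proof.
rewrite /= (@desc_fun_supported _ _ (gunit sigma_lh x)).
  by rewrite /= unit_coeffE (act_toE (g := gunit sigma_lh x)) act_unit.
split=> // g gx /=; rewrite /unit_coeff; case: pselect => //.
Qed.

End Descent.

Lemma injective_gamma_sheaf_forget (Q : gamma_sheaf sigma_lh) :
  injective_gamma_sheaf Q -> injective_sheaf Q.
Proof.
move=> Q_inj A B i f i_inj.
have [g gE] := Q_inj _ _ _ (desc f) (free_map_injective i_inj).
exists (hom_comp g (free_unit B)) => x a.
by have /= := free_unit_natural i a => ->; rewrite gE desc_unit.
Qed.

End FreeFunctor.

(** * Cocycles are sections *)

Section CocycleSections.
Variables (X : topologicalType) (sigma : X -> X).
Variables (sigma_lh : local_homeomorphism sigma) (A : gamma_sheaf sigma_lh).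
Local Notation Gamma := (groupoid sigma_lh).

Lemma act_irr x m m' y (p : tail_equiv sigma x m y) (p' : tail_equiv sigma x m' y)
    (a : A y) : m = m' ->
  act A (Arrow sigma_lh p) a = act A (Arrow sigma_lh p') a :> A x.
Proof. by move=> mE; subst m'; rewrite (Prop_irrelevance p p'). Qed.

Lemma coc_irr (f : cocycle A) x m m' y (p : tail_equiv sigma x m y)
    (p' : tail_equiv sigma x m' y) : m = m' ->
  f (Arrow sigma_lh p) = f (Arrow sigma_lh p') :> A x.
Proof. by move=> mE; subst m'; rewrite (Prop_irrelevance p p'). Qed.

(** The pairs (k, l) presenting an arrow; they differ by a common shift. *)
Definition tail_exponents (k l : nat) (g : Gamma) : Prop :=
  iter k sigma (rng g) = iter l sigma (src g) /\ k%:Z - l%:Z = deg g.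

Lemma tail_iter (k : nat) x z : iter k sigma x = z -> tail_equiv sigma x k z.
Proof. by move=> xz; exists k, 0%N; split=> //; rewrite subr0. Qed.

Section PathSum.
Variable s : forall x, A x.

(** The value that a cocycle with values s on the generators must take on the
    arrow from sigma^k x to x. *)
Fixpoint path_sum (k : nat) (x : X) : A x :=
  if k is k'.+1 then s x + act A (arrow_step sigma_lh x) (path_sum k' (sigma x))
  else 0.

(** The cocycle identity along a forward orbit. *)
Lemma path_sum_add (k j : nat) x z (p : tail_equiv sigma x k z) : iter k sigma x = z ->
  path_sum (k + j) x = path_sum k x + act A (Arrow sigma_lh p) (path_sum j z).
Proof.
elim: k x p => [|k IH] x p.
  move=> /= xz; subst z; rewrite add0r.
  by rewrite (act_irr p (tail_unit sigma x))// act_unit.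
rewrite iterSr => xz; have q := tail_iter xz.
rewrite addSn /= (IH _ q xz) raddfD addrA; congr (_ + _).
rewrite -(act_comp (tail_step sigma x) q); apply: act_irr.
by rewrite -PoszD.
Qed.

Definition arrow_value k l (g : Gamma) : A (rng g) :=
  path_sum k (rng g) - act A g (path_sum l (src g)).

Lemma arrow_value_add k l j g : tail_exponents k l g ->
  arrow_value (k + j) (l + j) g = arrow_value k l g.
Proof.
case: g => [x m y p] [/= kl klm]; rewrite /arrow_value /=.
have q := tail_iter (erefl (iter k sigma x)).
have r := tail_iter (esym kl).
rewrite (path_sum_add j q)// (path_sum_add j r)// raddfD -(act_comp p r).
rewrite (act_irr (tail_comp p r) q); last by rewrite -klm subrK.
by rewrite opprD addrACA subrr addr0.
Qed.

Lemma arrow_value_indep k l k' l' g :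
  tail_exponents k l g -> tail_exponents k' l' g ->
  arrow_value k l g = arrow_value k' l' g.
Proof.
wlog kk' : k l k' l' / (k <= k')%N.
  by move=> wl; have [|/ltnW] := leqP k k' => ? ? ?; [|apply/esym]; exact: wl.
move=> kl kl'.
have klE : (k + l' = k' + l)%N.
  have : (k%:Z + l'%:Z = k'%:Z + l%:Z)%R.
    by apply/eqP; rewrite -subr_eq addrAC kl.2 -kl'.2 subrK.
  by case.
have k'E : k' = (k + (k' - k))%N by rewrite subnKC.
have l'E : l' = (l + (k' - k))%N.
  by apply/eqP; rewrite -(eqn_add2l k) klE addnCA addnC subnKC// addnC.
by rewrite [in RHS]k'E [in RHS]l'E arrow_value_add.
Qed.

Definition section_cocycle_fun (g : Gamma) : A (rng g) :=
  let e := cid (arrowP g) in arrow_value (projT1 e) (projT1 (cid (projT2 e))) g.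

Lemma section_cocycle_funE k l g : tail_exponents k l g ->
  section_cocycle_fun g = arrow_value k l g.
Proof.
rewrite /section_cocycle_fun; case: cid => k' /= e; case: cid => l' /= [e' d].
exact: arrow_value_indep.
Qed.

(** Composable arrows have presentations (k, N) and (N, l) with the same exponent
    N at the middle point, whose two contributions cancel. *)
Lemma section_cocycle_comp x m y n z (p : tail_equiv sigma x m y)
    (q : tail_equiv sigma y n z) :
  section_cocycle_fun (Arrow sigma_lh (tail_comp p q)) =
  section_cocycle_fun (Arrow sigma_lh p) +
  act A (Arrow sigma_lh p) (section_cocycle_fun (Arrow sigma_lh q)).
Proof.
have [k [l [kl klm]]] := p; have [k' [l' [kl' klm']]] := q.
have ep : tail_exponents (k + k') (l + k') (Arrow sigma_lh p).
  by split; [rewrite /= addnC iterD kl -iterD addnC|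
             rewrite /= !PoszD opprD addrACA subrr addr0].
have eqq : tail_exponents (l + k') (l + l') (Arrow sigma_lh q).
  by split; [rewrite /= iterD kl' -iterD|rewrite /= !PoszD -klm' opprD addrACA subrr add0r].
have epq : tail_exponents (k + k') (l + l') (Arrow sigma_lh (tail_comp p q)).
  split; first by rewrite /= ep.1 eqq.1.
  by rewrite /= -klm -klm' !PoszD opprD addrACA.
rewrite (section_cocycle_funE ep) (section_cocycle_funE eqq).
rewrite (section_cocycle_funE epq) /arrow_value /= raddfB act_comp.
by rewrite addrA subrK.
Qed.

Hypothesis s_cont : continuous (fun x => etale_pt (s x)).

Lemma path_sum_continuous k : continuous (fun x => etale_pt (path_sum k x)).
Proof.
elim: k => [|k IH] x /=.
  by apply: etale_zero_continuous_for.
apply: etale_add_continuous_for; first exact: s_cont.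
apply: (@act_continuous_for _ _ _ A _ (arrow_step sigma_lh)
  (fun y => path_sum k (sigma y))).
  exact: arrow_step_continuous.
exact: (@continuous_comp _ _ _ sigma (fun y => etale_pt (path_sum k y)) _
  (sigma_continuous sigma_lh (x := x)) (IH (sigma x))).
Qed.

Lemma arrow_value_continuous k l :
  continuous (fun g => etale_pt (arrow_value k l g)).
Proof.
move=> g; apply: etale_sub_continuous_for.
  apply: (@continuous_comp _ _ _ (@rng _ _ sigma_lh)
    (fun y => etale_pt (path_sum k y))); first exact: rng_continuous.
  exact: path_sum_continuous.
apply: (@act_continuous_for _ _ _ A _ id (fun g : Gamma => path_sum l (src g))).
  exact: cvg_id.
apply: (@continuous_comp _ _ _ (@src _ _ sigma_lh)
    (fun y => etale_pt (path_sum l y))); first exact: src_continuous.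
exact: path_sum_continuous.
Qed.

Lemma section_cocycle_continuous :
  continuous (fun g => etale_pt (section_cocycle_fun g)).
Proof.
move=> g; have [k [l kl]] := bisection_near (@cvg_id _ (nbhs g)).
apply: continuous_for_near_eq (@arrow_value_continuous k l g).
by apply: filterS kl => h [dh eh]; rewrite (section_cocycle_funE (conj eh (esym dh))).
Qed.

Definition section_cocycle : cocycle A :=
  Cocycle section_cocycle_continuous section_cocycle_comp.

End PathSum.

Lemma phi_section_cocycle (s : global_section A) :
  phi (section_cocycle (@gsec_cont _ _ s)) = s.
Proof.
apply: global_section_ext => x /=.
rewrite (@section_cocycle_funE _ 1 0)// /arrow_value /=.
by rewrite (raddf0 (act A (arrow_step sigma_lh x))) subr0 addr0.
Qed.

Lemma cocycle_path_sum (f : cocycle A) (k : nat) x z (p : tail_equiv sigma x k z) :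
  iter k sigma x = z -> f (Arrow sigma_lh p) = path_sum (phi f) k x.
Proof.
elim: k x p => [|k IH] x p.
  move=> /= xz; subst z; pose u := tail_unit sigma x.
  have := coc_comp f u u; rewrite act_unit (coc_irr f (tail_comp u u) u)//.
  rewrite (coc_irr f p u)// => /eqP.
  by rewrite -subr_eq subrr eq_sym => /eqP.
rewrite iterSr => xz; have q := tail_iter xz.
rewrite (coc_irr f p (tail_comp (tail_step sigma x) q)); last by rewrite -PoszD.
by rewrite coc_comp (IH _ q xz).
Qed.

Lemma cocycle_arrow_value (f : cocycle A) k l g : tail_exponents k l g ->
  f g = arrow_value (phi f) k l g.
Proof.
case: g => [x m y p] [/= kl klm].
have q := tail_iter (erefl (iter k sigma x)).
have r := tail_iter (esym kl).
rewrite /arrow_value /= -(cocycle_path_sum f q)// -(cocycle_path_sum f r)//.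
rewrite -(coc_irr f (tail_comp p r)); last by rewrite -klm subrK.
by rewrite coc_comp addrK.
Qed.

Lemma phi_bijective : bijective (@phi _ _ _ A).
Proof.
apply: inj_surj_bij => [f f' ff'|s].
  apply: cocycle_ext => g; have [k [l [e d]]] := arrowP g.
  by rewrite !(@cocycle_arrow_value _ k l)// ff'.
by exists (section_cocycle (@gsec_cont _ _ s)); rewrite phi_section_cocycle.
Qed.

End CocycleSections.

Theorem theorem2 (X : topologicalType) (X_sc : @second_countable X)
    (X_lc : locally_compact [set: X]) (X_haus : hausdorff_space X)
    (sigma : X -> X) (sigma_lh : local_homeomorphism sigma)
    (A : gamma_sheaf sigma_lh) (n : nat)
    (Q : injective_gamma_resolution A) (J : injective_resolution A)
    (c : comparison Q J) :
  bijective (induced_phi c n).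
Proof.
pose I : injective_resolution A :=
  @InjectiveResolution X A (underlying_complex Q) (gires_aug Q) (gires_exact Q)
    (fun n => injective_gamma_sheaf_forget X_haus (@gires_inj _ _ _ _ Q n)).
apply: (@bij_comp _ _ _ (@cohomology_map _ _ (section_complex_map c) n)).
  exact: (@injective_resolutions_cohomology X A I J c n (comparison_aug c)).
by apply: cohomology_map_bij_degreewise => k; exact: phi_bijective.
Qed.
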